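(* Let $\alpha\in(0,1]$. Then the Kendall convolution $\vartriangle_\alpha$ is a weak generalized convolution. The corresponding weakly stable measure $\mu=\mu_\alpha$ (i.e. the symmetric weakly stable probability measure on $\mathbb{R}$ with $\vartriangle_\alpha=\otimes_{\mu}$) is given by the density function $$g_\alpha(t)=\frac{\alpha}{\pi}\,|t|^{-\alpha-1}\int_0^{|t|}x^{\alpha-1}\sin x\,dx,\qquad t\in\mathbb{R}\setminus\{0\}.$$
   Context: $\mathcal{P}_+$ and $\mathcal{P}$ are the sets of Borel probability measures on $[0,\infty)$ and $\mathbb{R}$; $\mathcal{P}_s\subset\mathcal{P}$ is the set of symmetric measures. $T_a\mu$ is the law of $aX$ when $X$ has law $\mu$; $\ast$ is the classical convolution; $\mathcal{L}(X)\circ\mathcal{L}(\theta)=\mathcal{L}(X\theta)$ for independent $X,\theta$. The Kendall convolution $\vartriangle_\alpha$ ($\alpha>0$) is the binary operation on $\mathcal{P}_+$ defined as follows. For $x\in[0,1]$, $\delta_x\vartriangle_\alpha\delta_1=(1-x^\alpha)\delta_1+x^\alpha\pi_{2\alpha}$, where $\pi_\beta$ is the Pareto distribution with density $\beta t^{-\beta-1}$ on $[1,\infty)$. For $a,b\ge0$ with $M=\max\{a,b\}$, $m=\min\{a,b\}$, $\delta_a\vartriangle_\alpha\delta_b=T_M(\delta_{m/M}\vartriangle_\alpha\delta_1)$ if $M>0$, and $\delta_0\vartriangle_\alpha\delta_0=\delta_0$. In general $\lambda_1\vartriangle_\alpha\lambda_2=\int_0^\infty\int_0^\infty(\delta_a\vartriangle_\alpha\delta_b)\,\lambda_1(da)\,\lambda_2(db)$.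 A measure $\mu\in\mathcal{P}$ is weakly stable if for all $a,b\in\mathbb{R}$ there is $\lambda\in\mathcal{P}$ such that $T_a\mu\ast T_b\mu=\lambda\circ\mu$. For a weakly stable $\mu\in\mathcal{P}_s$, the $\mu$-weak generalized convolution $\otimes_\mu$ on $\mathcal{P}_+$ is defined by: for $\lambda_1,\lambda_2,\lambda\in\mathcal{P}_+$, $$\lambda_1\otimes_\mu\lambda_2=\lambda\iff(\lambda_1\circ\mu)\ast(\lambda_2\circ\mu)=\lambda\circ\mu.$$ A binary operation $\diamond$ on $\mathcal{P}_+$ (a generalized convolution) is called a weak generalized convolution if $\diamond=\otimes_\mu$ for some weakly stable $\mu\in\mathcal{P}_s$. *)

(* Defs.v *)
From HB Require Import structures.
From mathcomp Require Import all_boot all_order all_algebra.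
From mathcomp Require Import all_classical all_reals all_analysis.
From mathcomp Require Import measurable_realfun giry.

Set Implicit Arguments.
Unset Strict Implicit.
Unset Printing Implicit Defensive.

Import Order.TTheory GRing.Theory Num.Theory.
Import numFieldNormedType.Exports.

Local Open Scope classical_set_scope.
Local Open Scope ring_scope.

Section laws.
Context {R : realType}.
Implicit Types mu nu : probability (measurableTypeR R) R.

Definition scale_fun (a x : measurableTypeR R) : measurableTypeR R := a * x.

Lemma measurable_scale_fun a : measurable_fun setT (scale_fun a).
Proof. by apply: measurable_funM. Qed.

HB.instance Definition _ a :=
  isMeasurableFun.Build _ _ _ _ (scale_fun a) (measurable_scale_fun a).

Definition add_fun2 (p : measurableTypeR R * measurableTypeR R) :
  measurableTypeR R := p.1 + p.2.

Lemma measurable_add_fun2 : measurable_fun setT add_fun2.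
Proof. by apply: measurable_funD; [exact: measurable_fst|exact: measurable_snd]. Qed.

HB.instance Definition _ :=
  isMeasurableFun.Build _ _ _ _ add_fun2 measurable_add_fun2.

Definition mul_fun2 (p : measurableTypeR R * measurableTypeR R) :
  measurableTypeR R := p.1 * p.2.

Lemma measurable_mul_fun2 : measurable_fun setT mul_fun2.
Proof. by apply: measurable_funM; [exact: measurable_fst|exact: measurable_snd]. Qed.

HB.instance Definition _ :=
  isMeasurableFun.Build _ _ _ _ mul_fun2 measurable_mul_fun2.

Definition dilation (a : R) mu : probability (measurableTypeR R) R :=
  distribution mu (scale_fun a).

Definition convolution mu nu : probability (measurableTypeR R) R :=
  distribution (mu \x nu)%E add_fun2.

(* The law of the product of two independent variables. *)
Definition product_law mu nu : probability (measurableTypeR R) R :=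
  distribution (mu \x nu)%E mul_fun2.

Definition symmetric_law mu : Prop := dilation (-1) mu ≡μ mu.

Definition weakly_stable mu : Prop :=
  forall a b : R, exists lambda : probability (measurableTypeR R) R,
    convolution (dilation a mu) (dilation b mu) ≡μ product_law lambda mu.

Definition has_density mu (g : R -> R) : Prop :=
  [/\ measurable_fun setT g, (forall t, 0 <= g t) &
      forall A : set R, measurable A ->
        mu A = (\int[lebesgue_measure]_(t in A) (g t)%:E)%E].

End laws.

(* Borel probability measures on [0, +oo[, seen as measures on R. *)
Record plaw (R : realType) := Plaw {
  plaw_law :> probability (measurableTypeR R) R;
  plaw_ge0 : plaw_law `[0%R, +oo[%classic = 1%E }.

Section weak_generalized_convolution.
Context {R : realType}.

(* Equality of operations is taken with respect to [≡μ], equality on Borel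
   sets: the values of a measure on other sets are unconstrained. *)
Definition is_weak_convolution (mu : probability (measurableTypeR R) R)
    (op : plaw R -> plaw R -> plaw R) : Prop :=
  forall l1 l2 l : plaw R,
    op l1 l2 ≡μ l <->
    convolution (product_law l1 mu) (product_law l2 mu) ≡μ product_law l mu.

Definition weakly_generated (op : plaw R -> plaw R -> plaw R)
    (mu : probability (measurableTypeR R) R) : Prop :=
  [/\ symmetric_law mu, weakly_stable mu & is_weak_convolution mu op].

Definition weak_generalized_convolution
    (op : plaw R -> plaw R -> plaw R) : Prop :=
  exists mu, weakly_generated op mu.

End weak_generalized_convolution.

Section pareto.
Context {R : realType}.

Definition pareto_pdf (beta : R) : R -> R :=
  (fun t => beta * t `^ (- beta - 1)) \_ `[1, +oo[.

Definition pareto_prob (beta : {posnum R}) : set (measurableTypeR R) -> \bar R :=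
  fun A => (\int[lebesgue_measure]_(t in A) (pareto_pdf beta%:num t)%:E)%E.

Section pdf.
Variables (b : R) (b_gt0 : 0 < b).

Lemma pareto_pdf_ge0 t : 0 <= pareto_pdf b t.
Proof. by apply: restrict_ge0 => x _; rewrite mulr_ge0 ?powR_ge0 ?ltW. Qed.

Lemma measurable_pareto_pdf : measurable_fun [set: R] (pareto_pdf b).
Proof.
apply/measurable_restrict => //; apply: measurable_funTS.
by apply: measurable_funM => //; exact: measurable_powR.
Qed.

Lemma integral_pareto_pdf :
  (\int[lebesgue_measure]_t (pareto_pdf b t)%:E = 1)%E.
Proof.
have -> : (\int[lebesgue_measure]_t (pareto_pdf b t)%:E =
  \int[lebesgue_measure]_(t in `[1%R, +oo[) (b * t `^ (- b - 1))%:E)%E.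
  rewrite [RHS]integral_mkcond; apply: eq_integral => x _.
  by rewrite /pareto_pdf !patchE; case: ifP.
have pos (x : R) : 1 <= x -> 0 < x by exact: lt_le_trans.
have der (x : R) : 0 < x ->
    is_derive x 1 (fun y : R => - (y `^ (- b))) (b * x `^ (- b - 1)).
  move=> x0; have h := @is_derive1_powR R (- b) x x0.
  by apply: is_derive_eq; rewrite mulNr opprK.
have cvgF (x : R) : 0 < x -> {for x, continuous (fun y : R => - (y `^ (- b)))}.
  move=> x0; apply: differentiable_continuous; apply/derivable1_diffP.
  by have [] := der x x0.
rewrite (@ge0_continuous_FTC2y R _ (fun x : R => - (x `^ (- b))) 1 0).
- by rewrite powR1 EFinN oppeK add0e.
- by move=> x _; rewrite mulr_ge0 ?powR_ge0 ?ltW.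
- apply: continuous_in_subspaceT => x; rewrite inE/= in_itv/= andbT => x1.
  apply: (@continuousM _ R^o (fun=> b) (fun y : R => y `^ (- b - 1))).
    exact: cst_continuous.
  apply: differentiable_continuous; apply/derivable1_diffP.
  by have [] := @is_derive1_powR R (- b - 1) x (pos _ x1).
- rewrite -[0 in X in _ --> X]oppr0; apply: cvgN.
  have -> : (fun x : R => x `^ (- b)) = (fun x => (x `^ b)^-1).
    by apply/funext => x; rewrite powRN.
  apply/gtr0_cvgV0.
    by near=> x; rewrite powR_gt0//; near: x; exact: nbhs_pinfty_gt.
  apply/cvgryPge => A; near=> x.
  have A0 : 0 <= `|A| by [].
  rewrite (le_trans (ler_norm A))//.
  rewrite -[leLHS](@powRr1 R)// -(@mulVf R b) ?gt_eqF// powRrM.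
  apply: ge0_ler_powR; rewrite ?nnegrE ?powR_ge0 ?ltW//.
- by move=> x x1; have [] := der x (lt_trans ltr01 x1).
- by apply: cvg_at_right_filter; exact: cvgF.
- move=> x; rewrite in_itv/= andbT => x1.
  by rewrite derive1E; apply: derive_val; exact: der (lt_trans ltr01 x1).
Unshelve. all: end_near. Qed.

End pdf.

Variable beta : {posnum R}.

Let pareto0 : pareto_prob beta set0 = 0%E.
Proof. exact: integral_set0. Qed.

Let pareto_ge0 A : (0 <= pareto_prob beta A)%E.
Proof. by apply: integral_ge0 => x _; rewrite lee_fin pareto_pdf_ge0. Qed.

Let pareto_sigma_additive : semi_sigma_additive (pareto_prob beta).
Proof.
move=> /= F mF tF mUF; rewrite /pareto_prob; apply: cvg_toP.
  apply: ereal_nondecreasing_is_cvgn => m n mn.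
  apply: lee_sum_nneg_natr => // k _ _; apply: integral_ge0 => /= x Fkx.
  by rewrite lee_fin pareto_pdf_ge0.
rewrite ge0_integral_bigcup//=.
- by apply/measurable_funTS/measurableT_comp => //; exact: measurable_pareto_pdf.
- by move=> x _; rewrite lee_fin pareto_pdf_ge0.
Qed.

HB.instance Definition _ := isMeasure.Build _ _ _
  (pareto_prob beta) pareto0 pareto_ge0 pareto_sigma_additive.

Let pareto_setT : pareto_prob beta [set: _] = 1%E.
Proof. exact: integral_pareto_pdf. Qed.

HB.instance Definition _ :=
  @Measure_isProbability.Build _ _ R (pareto_prob beta) pareto_setT.

End pareto.


Section kendall.
Context {R : realType}.
Variable alpha : {posnum R}.
Local Notation al := (alpha%:num).
Definition twice : {posnum R} := (2 * al)%:pos.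
Local Open Scope ereal_scope.

(* delta_x with delta_1, for 0 <= x <= 1. *)
Definition kendall_unit (x : R) : set (measurableTypeR R) -> \bar R := fun A =>
  (1 - x `^ al)%:E * \d_(1%R : measurableTypeR R) A +
  (x `^ al)%:E * pareto_prob twice A.

(* delta_a with delta_b; only the values at a, b >= 0 are used below. *)
Definition kendall_dirac (a b : R) : set (measurableTypeR R) -> \bar R :=
  let M := Num.max a b in
  let m := Num.min a b in
  if (0 < M)%R then pushforward (kendall_unit (m / M)) (scale_fun M)
  else \d_(0%R : measurableTypeR R).

Definition kendall_prob (l1 l2 : plaw R) : set (measurableTypeR R) -> \bar R :=
  fun A => \int[l1]_(a in `[0%R, +oo[) \int[l2]_(b in `[0%R, +oo[) kendall_dirac a b A.

Lemma kendall_diracP (a b : R) :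
  exists m : {measure set (measurableTypeR R) -> \bar R},
    kendall_dirac a b = m /\
    forall A : set (measurableTypeR R), measurable A -> `[0%R, +oo[ `<=` A -> m A = 1.
Proof.
rewrite /kendall_dirac; set M := Num.max a b; set x := (_ / _)%R.
case: ifPn => M0; last first.
  exists (\d_(0%R : measurableTypeR R)); split => // A mA sA.
  by rewrite /= diracE mem_set//; apply: sA; rewrite /= in_itv/= lexx.
have xal : (x `^ al <= 1)%R.
  have x1 : (x <= 1)%R by rewrite ler_pdivrMr// mul1r ge_min le_max lexx.
  have [x0|x0] := leP 0%R x.
    by rewrite -[leRHS](congr1 (@^~ al) (@powR1 R)); apply: ge0_ler_powR; rewrite ?nnegrE.
  by rewrite -[leLHS]ger0_norm ?powR_ge0// lt0_norm_powR.
have p0 : (0 <= 1 - x `^ al)%R by rewrite subr_ge0.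
pose q := NngNum (powR_ge0 x al).
pose m := measure_add (mscale (NngNum p0) (\d_(1%R : measurableTypeR R)))
                      (mscale q (pareto_prob twice)).
have mE : kendall_unit x = m by apply/funext => A; rewrite /m measure_addE.
exists (measure_function_pushforward__canonical__measure_function_Measure m
  (measurable_scale_fun M)); split; first by rewrite mE.
move=> A mA sA; pose B : set (measurableTypeR R) := scale_fun M @^-1` A.
transitivity (m B) => //; rewrite /m measure_addE /= /mscale/=.
have sB : `[0%R, +oo[ `<=` B.
  move=> t; rewrite /= in_itv/= andbT => t0; apply: sA.
  by rewrite /= in_itv/= andbT mulr_ge0// ltW.
have mB : measurable B.
  by rewrite -[B]setTI; exact: measurable_scale_fun.
rewrite diracE mem_set; last by apply: sB; rewrite /= in_itv/= ler01.
have -> : pareto_prob twice B = 1.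
  rewrite -(integral_pareto_pdf (b := 2 * al)%R)// /pareto_prob.
  rewrite integral_mkcond; apply: eq_integral => t _.
  rewrite patchE; case: ifPn => // tB.
  rewrite /pareto_pdf patchE ifF//; apply/negbTE; apply: contra tB.
  rewrite !inE/= in_itv/= andbT => t1; apply: sB.
  by rewrite /= in_itv/= andbT (le_trans _ t1).
by rewrite !mule1 -EFinD subrK.
Qed.

Lemma kendall_dirac_ge0 a b A : 0 <= kendall_dirac a b A.
Proof. by have [m [-> _]] := kendall_diracP a b. Qed.

Lemma measurable_kendall_dirac A : measurable A ->
  measurable_fun setT
    (fun p : measurableTypeR R * measurableTypeR R => kendall_dirac p.1 p.2 A).
Proof.
move=> mA.
pose Mx (p : measurableTypeR R * measurableTypeR R) : measurableTypeR R :=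
  Num.max p.1 p.2.
pose w p := (Num.min p.1 p.2 * (Mx p) `^ (-1))%R.
have mM : measurable_fun setT Mx.
  by apply: measurable_maxr; [exact: measurable_fst|exact: measurable_snd].
have mw : measurable_fun setT w.
  apply: measurable_funM.
    by apply: measurable_minr; [exact: measurable_fst|exact: measurable_snd].
  exact: (measurableT_comp (@measurable_powR R (-1)) mM).
have mwa : measurable_fun setT (fun p => w p `^ al)%R.
  exact: (measurableT_comp (@measurable_powR R al) mw).
pose S := mul_fun2 @^-1` A.
have mS : measurable S by rewrite -[S]setTI; exact: measurable_mul_fun2.
have SE c : xsection S c = scale_fun c @^-1` A.
  by apply/seteqP; split => t; rewrite /xsection /= inE.
have -> : (fun p : measurableTypeR R * measurableTypeR R =>
    kendall_dirac p.1 p.2 A) = (fun p => if (0 < Mx p)%R then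
      (1 - w p `^ al)%:E * (\1_A (Mx p))%:E +
      (w p `^ al)%:E * pareto_prob twice (xsection S (Mx p))
    else \d_(0%R : measurableTypeR R) A).
  apply/funext => p; rewrite /kendall_dirac -/(Mx p); case: ifPn => // M0.
  rewrite /pushforward /kendall_unit SE /w powR_inv1 ?ltW//.
  by rewrite !diracE indicE; congr (_ * (_ : bool)%:R%:E + _);
    apply/asbool_equiv_eq; rewrite /= /scale_fun mulr1.
apply: measurable_fun_ifT => //.
- exact: measurable_fun_ltr.
- apply: emeasurable_funD; apply: emeasurable_funM.
  + by apply/measurable_EFinP; exact: measurable_funB.
  + apply/measurable_EFinP.
    exact: (measurableT_comp (@measurable_indic _ _ R setT A mA) mM).
  + exact/measurable_EFinP.
  + exact: (measurableT_comp (measurable_fun_xsection (pareto_prob twice) mS) mM).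
Qed.

Let D : set (measurableTypeR R) := `[0%R, +oo[.

Let mD : measurable D. Proof. exact: measurable_itv. Qed.

Let measurable_inner (l2 : plaw R) A : measurable A ->
  measurable_fun setT
    (fun a : measurableTypeR R => \int[l2]_(b in D) kendall_dirac a b A).
Proof.
move=> mA.
pose f (p : measurableTypeR R * measurableTypeR R) : \bar R :=
  kendall_dirac p.1 p.2 A * (\1_D p.2)%:E.
have -> : (fun a : measurableTypeR R => \int[l2]_(b in D) kendall_dirac a b A) =
    fubini_F l2 f.
  apply/funext => a; rewrite /fubini_F /f/= integral_mkcond.
  apply: eq_integral => b _; rewrite patchE indicE.
  by case: ifPn => _; rewrite ?mule1 ?mule0.
apply: measurable_fun_fubini_tonelli_F.
  apply: emeasurable_funM; first exact: measurable_kendall_dirac.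
  apply/measurable_EFinP.
  exact: (measurableT_comp (@measurable_indic _ _ R setT D mD) measurable_snd).
by move=> p; rewrite mule_ge0 ?kendall_dirac_ge0// lee_fin.
Qed.

Let measurable_kendall_dirac2 (a : measurableTypeR R) A : measurable A ->
  measurable_fun D (fun b : measurableTypeR R => kendall_dirac a b A).
Proof.
move=> mA; apply: measurable_funTS.
exact: (measurableT_comp (measurable_kendall_dirac mA) (measurable_pair1 a)).
Qed.

Section measure.
Variables l1 l2 : plaw R.

Let kendall0 : kendall_prob l1 l2 set0 = 0.
Proof.
apply: integral0_eq => a _; apply: integral0_eq => b _.
by have [m [-> _]] := kendall_diracP a b.
Qed.

Let kendall_ge0 A : 0 <= kendall_prob l1 l2 A.
Proof.
apply: integral_ge0 => a _; apply: integral_ge0 => b _.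
exact: kendall_dirac_ge0.
Qed.

Let kendall_sigma_additive : semi_sigma_additive (kendall_prob l1 l2).
Proof.
move=> /= F mF tF mUF; rewrite /kendall_prob; apply: cvg_toP.
  apply: ereal_nondecreasing_is_cvgn => m n mn.
  by apply: lee_sum_nneg_natr => // k _ _; exact: kendall_ge0.
transitivity (\int[l1]_(a in D)
    \sum_(n <oo) \int[l2]_(b in D) kendall_dirac a b (F n)).
  rewrite integral_nneseries//.
  - by move=> n; apply: measurable_funTS; exact: measurable_inner.
  - by move=> n a _; apply: integral_ge0 => b _; exact: kendall_dirac_ge0.
apply: eq_integral => a _.
rewrite -integral_nneseries//.
- apply: eq_integral => b _; have [m [-> _]] := kendall_diracP a b.
  by rewrite measure_semi_bigcup.
- by move=> n; exact: measurable_kendall_dirac2.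
- by move=> n b _; exact: kendall_dirac_ge0.
Qed.

HB.instance Definition _ := isMeasure.Build _ _ _
  (kendall_prob l1 l2) kendall0 kendall_ge0 kendall_sigma_additive.

Let kendall_prob1 A : measurable A -> D `<=` A -> kendall_prob l1 l2 A = 1.
Proof.
move=> mA DA; rewrite /kendall_prob.
have one (l : plaw R) : \int[l]_(x in D) 1 = 1.
  by rewrite integral_cst// mul1e; exact: plaw_ge0.
rewrite -[RHS](one l1); apply: eq_integral => a _.
rewrite -[RHS](one l2); apply: eq_integral => b _.
by have [m [-> ->]] := kendall_diracP a b.
Qed.

Let kendall_setT : kendall_prob l1 l2 [set: _] = 1.
Proof. exact: kendall_prob1. Qed.

HB.instance Definition _ :=
  @Measure_isProbability.Build _ _ R (kendall_prob l1 l2) kendall_setT.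

Lemma kendall_prob_ge0 :
  (kendall_prob l1 l2 : probability (measurableTypeR R) R) `[0%R, +oo[%classic = 1.
Proof. exact: kendall_prob1. Qed.

Definition kendall : plaw R := Plaw kendall_prob_ge0.

End measure.
End kendall.

(* The value at t = 0 is 0 since [powR 0] vanishes off exponent 0. *)
Definition kendall_pdf {R : realType} (alpha t : R) : R :=
  alpha / pi * `|t| `^ (- alpha - 1) *
    (\int[lebesgue_measure]_(x in `[0, `|t|]) (x `^ (alpha - 1) * sin x))%R.

(* Main.v *)
Require Import Defs.
From HB Require Import structures.
From mathcomp Require Import all_boot all_order all_algebra.
From mathcomp Require Import all_classical all_reals all_analysis.
From mathcomp Require Import measurable_realfun giry ring lra.

Set Implicit Arguments.
Unset Strict Implicit.
Unset Printing Implicit Defensive.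

Import Order.TTheory GRing.Theory Num.Theory.
Import numFieldNormedType.Exports.

Local Open Scope classical_set_scope.
Local Open Scope ring_scope.

(** The cosine transform of [mu_alpha] is [phi t = max 0 (1 - |t|^alpha)]: substituting
    [x = t v^(1/alpha)] in the inner integral of the density gives
    [g t = pi^-1 int_0^1 sin (v^(1/alpha) t) / t dv], and after exchanging integrals the
    truncated cosine transform of [g] is an average over [v] of Dirichlet integrals, which
    converge boundedly (write [1 / t = int_0^oo e^(-st) ds]).
    The function [phi] is multiplicative for the Kendall convolution, written [*] below:
    if [X] has law [l1 * l2], then [E phi(tX) = (int phi(ta) l1(da)) (int phi(tb) l2(db))], and the
    left-hand side for all [t] (a Williamson transform) determines the law of [X].
    As symmetric laws are determined by their cosine transforms, [*] is the weak
    generalized convolution of [mu_alpha].  Conversely, if [nu] generates [*] and [psi] is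
    its cosine transform, then evaluating at [delta_x] and [delta_1] gives
    [psi (t x) = 1 - x^alpha (1 - psi t)] for [0 <= x <= 1] whenever [psi t <> 0], which
    forces [psi t = phi (c t)]. *)

(** * Integration of real-valued functions *)

(** The function [sin (z t) / t] is not absolutely integrable at infinity, so integrals over the
    whole half-line cannot be exchanged directly. Everything is truncated at [T], and what passes to
    the limit is one bound, [pi / 2 + 2], on the truncated sine integrals, uniform in [T] and in the
    frequency. It serves twice: for the transform of [g], and for the inversion that makes cosine
    transforms injective. The total mass of [g] also comes out of this limit, as the value at
    [x = 0]. The condition [alpha <= 1] makes [g] nonnegative: an integration by parts leaves the
    factor [1 - alpha]. The Pareto exponent [2 alpha] makes [phi] multiplicative: averaging
    [max 0 (1 - A s^alpha)] over that law gives the square of [max 0 (1 - A)]. In the converse, the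
    scaling relation is available only where [psi t] is nonzero, so the zeros of [psi] have to be
    located by continuity and by [|psi| <= 1]. *)

Section bounded_integrals.
Context d (T : measurableType d) (R : realType) (mu : {measure set T -> \bar R}).
Variables (D : set T) (mD : measurable D) (muD : (mu D < +oo)%E) (C : R).

Lemma bounded_integrable (f : T -> R) : measurable_fun D f ->
  (forall x, D x -> `|f x| <= C) -> mu.-integrable D (EFin \o f).
Proof.
move=> mf fC; apply: measurable_bounded_integrable => //.
by exists C; split; [exact: num_real|move=> M CM x /= Dx; rewrite (le_trans (fC _ Dx))// ltW].
Qed.

(** Dominated convergence with a constant majorant. It suffices for truncated kernels, indicators of
    growing intervals and difference quotients, which are all uniformly bounded. *)
Lemma bounded_Rintegral_cvg (f_ : nat -> T -> R) (f : T -> R) :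
  (forall n, measurable_fun D (f_ n)) ->
  (forall n x, D x -> `|f_ n x| <= C) ->
  (forall x, D x -> f_ n x @[n --> \oo] --> f x) ->
  \int[mu]_(x in D) f_ n x @[n --> \oo] --> \int[mu]_(x in D) f x.
Proof.
move=> mf_ f_C f_f.
have mf : measurable_fun D f by apply: measurable_fun_cvg f_f.
have fC x : D x -> `|f x| <= C.
  move=> Dx; have /cvg_norm cf := f_f _ Dx.
  rewrite -(cvg_lim _ cf)//; apply: limr_le; first by apply: cvgP cf.
  by near=> n; exact: f_C.
have cst_int : mu.-integrable D (EFin \o cst C).
  by apply: measurable_bounded_integrable => //; exact: bounded_cst.
have fin : (\int[mu]_(x in D) (f x)%:E)%E \is a fin_num.
  by apply: integrable_fin_num => //; exact: bounded_integrable.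
have fcvg : ((\int[mu]_(x in D) (f_ n x)%:E)%E @[n --> \oo] -->
    (\int[mu]_(x in D) (f x)%:E)%E).
  apply: (@dominated_cvg _ _ _ mu D mD (fun n x => (f_ n x)%:E) _ (EFin \o cst C)) => //.
  - by move=> n; exact/measurable_EFinP.
  - by move=> x Dx; apply: cvg_EFin; [exact: nearW|exact: f_f].
by move: fcvg; rewrite -(fineK fin) => /fine_cvg.
Unshelve. all: by end_near. Qed.

Lemma le_norm_Rintegral (f : T -> R) : measurable_fun D f ->
  (forall x, D x -> `|f x| <= C) ->
  `|\int[mu]_(x in D) f x| <= C * fine (mu D).
Proof.
move=> mf fC; have fi := bounded_integrable mf fC.
rewrite (le_trans (le_normr_Rintegral _ fi))// -Rintegral_cst//.
apply: le_Rintegral => //; first exact: integrable_norm.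
by apply: measurable_bounded_integrable => //; exact: bounded_cst.
Qed.

End bounded_integrals.

(** * Fubini for real-valued integrals over subdomains *)

Section real_fubini.
Context d1 d2 (T1 : measurableType d1) (T2 : measurableType d2) (R : realType).
Variables (m1 : {sigma_finite_measure set T1 -> \bar R})
  (m2 : {sigma_finite_measure set T2 -> \bar R}).
Variables (D1 : set T1) (D2 : set T2).
Hypotheses (mD1 : measurable D1) (mD2 : measurable D2).
Variable f : T1 * T2 -> R.
Hypothesis mf : measurable_fun (D1 `*` D2) f.
Hypothesis f1 : forall x, D1 x -> m2.-integrable D2 (fun y => (f (x, y))%:E).
Hypothesis f2 : forall y, D2 y -> m1.-integrable D1 (fun x => (f (x, y))%:E).
Hypothesis f12 : (\int[m1]_(x in D1) \int[m2]_(y in D2) `|f (x, y)|%:E < +oo)%E.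

(** Extension by zero turns the iterated integrals over [D1] and [D2] into integrals over the whole
    product space. *)
Let g := (EFin \o f) \_ (D1 `*` D2).

Let mg : measurable_fun setT g.
Proof.
apply/(measurable_restrictT _ _).1; first exact: measurableX.
exact/measurable_EFinP.
Qed.

Let gF x : (\int[m2]_y g (x, y))%E =
  (((fun x => \int[m2]_(y in D2) (f (x, y))%:E) \_ D1) x)%E.
Proof.
rewrite patchE; case: ifPn => xD1.
  rewrite [RHS]integral_mkcond; apply: eq_integral => y _.
  by rewrite /g !patchE in_setX xD1.
by apply: integral0_eq => y _; rewrite /g patchE in_setX (negbTE xD1).
Qed.

Let gG y : (\int[m1]_x g (x, y))%E =
  (((fun y => \int[m1]_(x in D1) (f (x, y))%:E) \_ D2) y)%E.
Proof.
rewrite patchE; case: ifPn => yD2.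
  rewrite [RHS]integral_mkcond; apply: eq_integral => x _.
  by rewrite /g !patchE in_setX yD2 andbT.
by apply: integral0_eq => x _; rewrite /g patchE in_setX (negbTE yD2) andbF.
Qed.

Let ig : (m1 \x m2)%E.-integrable setT g.
Proof.
apply/(integrable12ltyP _ _ mg); rewrite (le_lt_trans _ f12)//.
rewrite [in leRHS]integral_mkcond; apply: ge0_le_integral => //.
- by move=> x _; exact: integral_ge0.
- apply: (measurable_fun_fubini_tonelli_F (abse \o g)) => //=.
  exact: measurableT_comp.
- have -> : ((fun x => \int[m2]_(y in D2) `|f (x, y)|%:E) \_ D1 =
      fubini_F m2 (abse \o g))%E.
    apply/funext => x; rewrite patchE /fubini_F/=; case: ifPn => xD1.
      rewrite integral_mkcond; apply: eq_integral => y _.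
      by rewrite /g !patchE in_setX xD1/=; case: ifPn => // _; rewrite abse0.
    by rewrite integral0_eq// => y _; rewrite /g patchE in_setX (negbTE xD1) abse0.
  apply: measurable_fun_fubini_tonelli_F => //=; exact: measurableT_comp.
- move=> x _; rewrite patchE; case: ifPn => xD1.
    rewrite [leRHS]integral_mkcond le_eqVlt; apply/orP; left; apply/eqP.
    apply: eq_integral => y _.
    by rewrite /g !patchE in_setX xD1/=; case: ifPn => // _; rewrite abse0.
  by rewrite integral0_eq// => y _; rewrite /g patchE in_setX (negbTE xD1) abse0.
Qed.

(** [fine] loses nothing only on a finite inner integral. This is why every section is assumed
    integrable, and not just almost every one. *)
Let F1 x : D1 x ->
  (\int[m2]_(y in D2) f (x, y))%:E = (\int[m2]_(y in D2) (f (x, y))%:E)%E.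
Proof. by move=> x1; rewrite fineK//; apply: integrable_fin_num => //; exact: f1. Qed.

Let F2 y : D2 y ->
  (\int[m1]_(x in D1) f (x, y))%:E = (\int[m1]_(x in D1) (f (x, y))%:E)%E.
Proof. by move=> y2; rewrite fineK//; apply: integrable_fin_num => //; exact: f2. Qed.

Lemma integrable_Rintegral :
  m1.-integrable D1 (EFin \o (fun x => \int[m2]_(y in D2) f (x, y))).
Proof.
apply/integrable_mkcond => //.
apply: eq_integrable (integrable_fubini_F ig) => // x _.
rewrite /fubini_F gF !patchE; case: ifPn => // /set_mem x1.
by rewrite /= F1.
Qed.

Lemma Rintegral_swap :
  \int[m1]_(x in D1) (\int[m2]_(y in D2) f (x, y)) =
  \int[m2]_(y in D2) (\int[m1]_(x in D1) f (x, y)).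
Proof.
congr fine.
transitivity (\int[m1]_x \int[m2]_y g (x, y))%E.
  rewrite integral_mkcond; apply: eq_integral => x _.
  by rewrite gF !patchE; case: ifPn => // /set_mem /F1.
rewrite (Fubini ig) [RHS]integral_mkcond; apply: eq_integral => y _.
by rewrite gG !patchE; case: ifPn => // /set_mem /F2.
Qed.

End real_fubini.

Section bounded_fubini.
Context d1 d2 (T1 : measurableType d1) (T2 : measurableType d2) (R : realType).
Variables (m1 : {sigma_finite_measure set T1 -> \bar R})
  (m2 : {sigma_finite_measure set T2 -> \bar R}).
Variables (D1 : set T1) (D2 : set T2).
Hypotheses (mD1 : measurable D1) (mD2 : measurable D2).
Hypotheses (fD1 : (m1 D1 < +oo)%E) (fD2 : (m2 D2 < +oo)%E).
Variables (f : T1 * T2 -> R) (C : R).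
Hypothesis mf : measurable_fun (D1 `*` D2) f.
Hypothesis fC : forall x y, D1 x -> D2 y -> `|f (x, y)| <= C.

Let m1f y : D2 y -> measurable_fun D1 (fun x => f (x, y)).
Proof.
move=> y2; apply: (measurable_comp _ _ mf) => //; first exact: measurableX.
- by move=> _ [x x1 <-].
- exact/measurable_funTS/pair2_measurable.
Qed.

Let m2f x : D1 x -> measurable_fun D2 (fun y => f (x, y)).
Proof.
move=> x1; apply: (measurable_comp _ _ mf) => //; first exact: measurableX.
- by move=> _ [y y2 <-].
- exact/measurable_funTS/pair1_measurable.
Qed.

Let f1 x : D1 x -> m2.-integrable D2 (fun y => (f (x, y))%:E).
Proof.
move=> x1; apply: (@bounded_integrable _ _ _ m2 _ mD2 fD2 C) => //.
  exact: m2f.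
by move=> y y2; exact: fC.
Qed.

Let f2 y : D2 y -> m1.-integrable D1 (fun x => (f (x, y))%:E).
Proof.
move=> y2; apply: (@bounded_integrable _ _ _ m1 _ mD1 fD1 C) => //.
  exact: m1f.
by move=> x x1; exact: fC.
Qed.

Let f12 : (\int[m1]_(x in D1) \int[m2]_(y in D2) `|f (x, y)|%:E < +oo)%E.
Proof.
(* The absolute value matters: [C] is unconstrained, hence possibly negative, when [D1] or [D2] is
   empty. *)
pose K := (`|C|%:E * m2 D2)%E.
have K0 : (0 <= K)%E by rewrite mule_ge0.
have Kfin : K \is a fin_num.
  by rewrite fin_numM// ge0_fin_numE.
have fK x : D1 x -> (\int[m2]_(y in D2) `|f (x, y)|%:E <= K)%E.
  move=> x1; rewrite /K -(integral_cst _ mD2 `|C|%:E).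
  apply: ge0_le_integral => //.
  - by apply/measurable_EFinP/measurableT_comp => //; exact: m2f.
  - by move=> y y2; rewrite lee_fin (le_trans (fC x1 y2))// ler_norm.
apply: (@le_lt_trans _ _ (\int[m1]_(x in D1) K)%E).
  rewrite [leLHS]integral_mkcond [leRHS]integral_mkcond.
  have h0 x : (0 <= ((fun x => \int[m2]_(y in D2) `|f (x, y)|%:E) \_ D1) x)%E.
    by rewrite patchE; case: ifPn => // _; apply: integral_ge0 => y _; rewrite lee_fin.
  apply: ge0_le_integral => //.
  - have -> : ((fun x => \int[m2]_(y in D2) `|f (x, y)|%:E) \_ D1 =
      fubini_F m2 (abse \o ((EFin \o f) \_ (D1 `*` D2))))%E.
      apply/funext => x; rewrite patchE /fubini_F/=; case: ifPn => xD1.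
        rewrite integral_mkcond; apply: eq_integral => y _.
        by rewrite !patchE in_setX xD1/=; case: ifPn => // _; rewrite abse0.
      by rewrite integral0_eq// => y _; rewrite patchE in_setX (negbTE xD1) abse0.
    apply: measurable_fun_fubini_tonelli_F => //=; apply: measurableT_comp => //.
    apply/(measurable_restrictT _ _).1; first exact: measurableX.
    exact/measurable_EFinP.
  - by apply/(measurable_restrictT _ _).1 => //.
  - by move=> x _; rewrite !patchE; case: ifPn => // /set_mem; exact: fK.
rewrite -(fineK Kfin) integral_cst// ltey_eq fin_numM//.
by rewrite ge0_fin_numE.
Qed.

Lemma bounded_integrable_Rintegral :
  m1.-integrable D1 (EFin \o (fun x => \int[m2]_(y in D2) f (x, y))).
Proof. exact: integrable_Rintegral. Qed.

Lemma bounded_Rintegral_swap :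
  \int[m1]_(x in D1) (\int[m2]_(y in D2) f (x, y)) =
  \int[m2]_(y in D2) (\int[m1]_(x in D1) f (x, y)).
Proof. exact: Rintegral_swap. Qed.

End bounded_fubini.

(** * Integration against a mixture of measures *)

Section mixtures.
Context d1 d2 (T1 : measurableType d1) (T2 : measurableType d2) (R : realType).
Variables (P : {measure set T1 -> \bar R}) (k : T1 -> {measure set T2 -> \bar R}).
Variable M : {measure set T2 -> \bar R}.
Hypothesis mk : forall A, measurable A -> measurable_fun setT (fun x => k x A).
Hypothesis Mk : forall A, measurable A -> M A = (\int[P]_x k x A)%E.
Local Open Scope ereal_scope.

Import HBNNSimple.

Let measurable_sintegral (h : {nnsfun T2 >-> R}) :
  measurable_fun setT (fun x => sintegral (k x) h).
Proof.
under eq_fun do rewrite sintegralE.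
apply: emeasurable_fsum => //= r.
by apply: measurable_funeM => //=; exact: mk.
Qed.

Let sintegral_mixture (h : {nnsfun T2 >-> R}) :
  sintegral M h = \int[P]_x sintegral (k x) h.
Proof.
under eq_integral do rewrite sintegralE.
rewrite ge0_integral_fsum//; last 2 first.
  by move=> r; apply: measurable_funeM; exact: mk.
  by move=> n x _; exact: nnsfun_mulemu_ge0.
rewrite sintegralE /=; apply: eq_fsbigr => r /set_mem[t _ <-].
by rewrite ge0_integralZl//; [rewrite Mk|exact: mk|rewrite lee_fin].
Qed.

Variable f : T2 -> \bar R.
Hypotheses (mf : measurable_fun setT f) (f0 : forall y, 0 <= f y).

Let g := nnsfun_approx measurableT mf.

Let cvg_k x : \int[k x]_y (g n y)%:E @[n --> \oo] --> \int[k x]_y f y.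
Proof.
have -> : \int[k x]_y f y = \int[k x]_y limn (EFin \o g ^~ y).
  by apply: eq_integral => y _; apply/esym/cvg_lim => //; exact/cvg_nnsfun_approx.
apply: cvg_monotone_convergence => //.
- by move=> n; exact/measurable_EFinP.
- by move=> n y _; rewrite lee_fin.
- by move=> y _ n m nm; rewrite lee_fin; exact/lefP/nd_nnsfun_approx.
Qed.

Let mg n : measurable_fun setT (fun x => \int[k x]_y (g n y)%:E).
Proof. by under eq_fun do rewrite integralT_nnsfun; exact: measurable_sintegral. Qed.

Lemma measurable_integral_mixture : measurable_fun setT (fun x => \int[k x]_y f y).
Proof. by apply: (emeasurable_fun_cvg _ _ mg) => x _; exact: cvg_k. Qed.

(** Linearity gives the identity for simple functions and monotone convergence extends it. It is
    used for laws with a density and for the Kendall convolution. *)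
Lemma ge0_integral_mixture : \int[M]_y f y = \int[P]_x \int[k x]_y f y.
Proof.
transitivity (limn (fun n => \int[M]_y (g n y)%:E)).
  rewrite -monotone_convergence//.
  - by apply: eq_integral => y _; apply/esym/cvg_lim => //; exact/cvg_nnsfun_approx.
  - by move=> n; exact/measurable_EFinP.
  - by move=> n y _; rewrite lee_fin.
  - by move=> y _ n m nm; rewrite lee_fin; exact/lefP/nd_nnsfun_approx.
transitivity (limn (fun n => \int[P]_x \int[k x]_y (g n y)%:E)).
  apply: congr_lim; apply/funext => n.
  rewrite integralT_nnsfun sintegral_mixture; apply: eq_integral => x _.
  by rewrite integralT_nnsfun.
rewrite -monotone_convergence//.
- by apply: eq_integral => x _; apply/cvg_lim => //; exact: cvg_k.
- by move=> n x _; apply: integral_ge0 => y _; rewrite lee_fin.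
- move=> x _ n m nm; apply: ge0_le_integral => //.
  + by move=> y _; rewrite lee_fin.
  + exact/measurable_EFinP.
  + exact/measurable_EFinP.
  + by move=> y _; rewrite lee_fin; exact/lefP/nd_nnsfun_approx.
Qed.

End mixtures.

Section density.
Context d (T : measurableType d) (R : realType) (m mu : {measure set T -> \bar R}).
Variable g : T -> R.
Hypotheses (mg : measurable_fun setT g) (g0 : forall t, 0 <= g t).
Hypothesis mE : forall A, measurable A -> m A = (\int[mu]_(t in A) (g t)%:E)%E.
Local Open Scope ereal_scope.

Lemma ge0_integral_density (f : T -> \bar R) :
  measurable_fun setT f -> (forall y, 0 <= f y) ->
  \int[m]_y f y = \int[mu]_t ((g t)%:E * f t).
Proof.
(* A law with density [g] is the mixture over [t] of the point masses of weight [g t] at [t]. *)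
move=> mf f0; pose k t : {measure set T -> \bar R} :=
  mscale (NngNum (g0 t)) \d_t.
rewrite (@ge0_integral_mixture _ _ _ _ _ mu k)//.
- apply: eq_integral => t _.
  by rewrite ge0_integral_mscale// integral_dirac// diracT mul1e.
- move=> A mA; apply: emeasurable_funM => //; first exact/measurable_EFinP.
  exact: measurable_fun_dirac.
- move=> A mA; rewrite mE// integral_mkcond; apply: eq_integral => t _.
  by rewrite patchE /k /= /mscale /= diracE; case: ifPn; rewrite ?mule1 ?mule0.
Qed.

End density.

(** * Elementary functions and explicit integrals *)

Section elementary.
Context {R : realType}.
Implicit Types x y z t s T : R.

Lemma measurable_inv : measurable_fun setT (fun t : R => t^-1).
Proof.
(* The right-hand side is a product of measurable functions, and both sides are [0] at [t = 0]. *)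
have -> : (fun t : R => t^-1) = (fun t => t * (`|t| `^ (-1)) ^+ 2).
  apply/funext => t; rewrite powR_inv1//; have [->|t0] := eqVneq t 0.
    by rewrite mul0r invr0.
  by rewrite exprVn real_normK ?num_real// expr2 invfM mulrA mulfV// mul1r.
apply: measurable_funM => //; apply: measurable_funX.
by apply: (measurableT_comp (@measurable_powR R (-1))) => //; exact: normr_measurable.
Qed.

Lemma measurable_sin : measurable_fun setT (@sin R).
Proof. by apply: continuous_measurable_fun; exact: continuous_sin. Qed.

Lemma measurable_cos : measurable_fun setT (@cos R).
Proof. by apply: continuous_measurable_fun; exact: continuous_cos. Qed.

Lemma normr_sin_le x : `|sin x| <= `|x|.
Proof.
wlog x0 : x / 0 <= x => [H|].
  have [/H//|/ltW x0] := leP 0 x.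
  by rewrite -normrN -sinN -(normrN x) H// oppr_ge0.
have [c _] : exists2 c, c \in `[0, x] & sin x - sin 0 = cos c * (x - 0).
  apply: MVT_segment => //.
  by apply: continuous_subspaceT; exact: continuous_sin.
rewrite sin0 !subr0 => ->; rewrite normrM.
by rewrite ler_piMl// cos_max.
Qed.

(** Removes the singularity at [t = 0], so that integrals over a truncated range have bounded
    integrands. *)
Lemma normr_sinV_le z t : `|sin (z * t) / t| <= `|z|.
Proof.
have [->|t0] := eqVneq t 0; first by rewrite invr0 mulr0 normr0.
by rewrite normf_div ler_pdivrMr ?normr_gt0// -normrM normr_sin_le.
Qed.

(** The antiderivative is the imaginary part of [exp ((- s + i z) t) / (- s + i z)]. *)
Lemma is_derive_exp_sin s z t : s ^+ 2 + z ^+ 2 != 0 ->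
  is_derive t (1 : R)
    (fun t => - (expR (- (s * t)) * (s * sin (z * t) + z * cos (z * t))) /
              (s ^+ 2 + z ^+ 2)) (expR (- (s * t)) * sin (z * t)).
Proof.
move=> sz0.
apply: is_derive_eq; rewrite /GRing.scale/=.
by field.
Qed.

Lemma is_derive_continuous (F : R -> R) x d :
  is_derive x 1 F d -> {for x, continuous F}.
Proof.
by move=> [dF _]; apply: differentiable_continuous; exact/derivable1_diffP.
Qed.

Lemma integral_FTC2 (f F : R -> R) a b : a <= b ->
  (forall x, a <= x <= b -> is_derive x 1 F (f x)) ->
  (forall x, a <= x <= b -> {for x, continuous f}) ->
  (\int[lebesgue_measure]_(x in `[a, b]) (f x)%:E = (F b - F a)%:E)%E.
Proof.
rewrite le_eqVlt => /predU1P[->|ab] dF cf.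
  by rewrite set_itv1 integral_set1 subrr.
have cF x : a <= x <= b -> {for x, continuous F}.
  by move=> axb; exact: is_derive_continuous (dF x axb).
have ooW x : x \in `]a, b[ -> a <= x <= b.
  by rewrite in_itv/= => /andP[/ltW -> /ltW].
rewrite EFinB (@continuous_FTC2 _ _ F)//.
- by apply: continuous_in_subspaceT => x; rewrite inE/= in_itv/= => /cf.
- split.
  + by move=> x /ooW/dF[].
  + by apply: cvg_at_right_filter; apply: cF; rewrite lexx ltW.
  + by apply: cvg_at_left_filter; apply: cF; rewrite lexx ltW.
- by move=> x /ooW/dF; rewrite derive1E => -[].
Qed.

Lemma Rintegral_FTC2 (f F : R -> R) a b : a <= b ->
  (forall x, a <= x <= b -> is_derive x 1 F (f x)) ->
  (forall x, a <= x <= b -> {for x, continuous f}) ->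
  \int[lebesgue_measure]_(x in `[a, b]) f x = F b - F a.
Proof. by move=> ab dF cf; rewrite /Rintegral (integral_FTC2 ab dF cf). Qed.

Lemma integral0y_FTC2 (f F : R -> R) l :
  (forall x, 0 <= f x) -> (forall x, is_derive x 1 F (f x)) -> continuous f ->
  F x @[x --> +oo] --> l ->
  (\int[lebesgue_measure]_(x in `[0%R, +oo[) (f x)%:E = (l - F 0)%:E)%E.
Proof.
move=> f0 dF cf Fl.
have cF x : {for x, continuous F} by apply: is_derive_continuous (dF x).
rewrite EFinB (ge0_continuous_FTC2y _ _ Fl)//.
- exact: continuous_subspaceT.
- by apply: cvg_at_right_filter; exact: cF.
- by move=> x _; rewrite derive1E; have [_] := dF x.
Qed.

Lemma integral0y_expR T : 0 < T ->
  (\int[lebesgue_measure]_(s in `[0%R, +oo[) (expR (- (s * T)))%:E = (T^-1)%:E)%E.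
Proof.
move=> T0; have T0' : T != 0 by rewrite gt_eqF.
transitivity (0 - - (expR (- (0 * T)) / T))%:E; last first.
  by rewrite mul0r oppr0 expR0 sub0r opprK mul1r.
apply: (@integral0y_FTC2 (fun s : R => expR (- (s * T)))
  (fun s : R => - (expR (- (s * T)) / T)) 0).
- by move=> s; exact: expR_ge0.
- move=> s; apply: is_derive_eq; rewrite /GRing.scale/=; by field.
- move=> s; apply: continuous_comp; last exact: continuous_expR.
  by apply: cvgN; apply: cvgM => //; exact: cvg_cst.
- rewrite -oppr0; apply: cvgN; rewrite -(mul0r T^-1).
  apply: cvgM; last exact: cvg_cst.
  rewrite (_ : (fun s => expR (- (s * T))) =
               (fun z => expR (- z)) \o (fun z => z * T))//.
  apply: (@cvg_comp _ _ _ _ _ _ (pinfty_nbhs R)); last exact: cvgr_expR.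
  exact: gt0_cvgMly.
Qed.

Lemma integral0y_cauchy z : 0 < z ->
  (\int[lebesgue_measure]_(s in `[0%R, +oo[) (z / (s ^+ 2 + z ^+ 2))%:E =
  (pi / 2)%:E)%E.
Proof.
move=> z0; have z0' : z != 0 by rewrite gt_eqF.
have sz (s : R) : s ^+ 2 + z ^+ 2 != 0.
  by rewrite gt_eqF// ltr_wpDl ?sqr_ge0// exprn_gt0.
transitivity (pi / 2 - atan (0 / z))%:E; last by rewrite mul0r atan0 subr0.
apply: (@integral0y_FTC2 (fun s : R => z / (s ^+ 2 + z ^+ 2))
  (fun s : R => atan (s / z)) (pi / 2)).
- by move=> s; rewrite divr_ge0 ?(ltW z0)// addr_ge0 ?sqr_ge0.
- move=> s; apply: is_derive_eq; rewrite /GRing.scale/=; field.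
  by rewrite z0' sz.
- move=> s; apply: cvgM; first exact: cvg_cst.
  apply: cvgV => //; apply: cvgD; last exact: cvg_cst.
  exact: exprn_continuous.
- apply: (@cvg_comp _ _ _ (fun s => s / z) atan _ (pinfty_nbhs R)); last exact: cvgy_atan.
  by apply: gt0_cvgMly; rewrite ?invr_gt0.
Qed.

End elementary.

(** * Dirichlet integrals *)

Section dirichlet.
Context {R : realType}.
Notation leb := (@lebesgue_measure R).
Implicit Types x y z t s T : R.

(** For [z > 0] this is the classical [Si (z T)]. Truncation and frequency are kept apart because
    the frequency is averaged at fixed [T]. *)
Definition sine_integral (T z : R) : R :=
  \int[leb]_(t in `]0, T]) (sin (z * t) / t).

Lemma lebesgue_itv_lty (a b : R) (b1 b2 : bool) :
  (leb [set` Interval (BSide b1 a) (BSide b2 b)] < +oo)%E.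
Proof. by rewrite lebesgue_measure_itv/=; case: ifP => // _; rewrite -EFinB ltry. Qed.

Lemma fine_lebesgue_0T T : 0 <= T -> fine (leb `]0, T]) = T.
Proof.
move=> T0; rewrite lebesgue_measure_itv/= lte_fin.
case: ltP => /= [_|T0']; first by rewrite oppr0 addr0.
by apply/eqP; rewrite eq_le T0 T0'.
Qed.

Lemma measurable_sinV z : measurable_fun setT (fun t => sin (z * t) / t).
Proof.
apply: measurable_funM; last exact: measurable_inv.
by apply: measurableT_comp; [exact: measurable_sin|exact: measurable_funM].
Qed.

Lemma integral_expR_sin s z T : 0 <= T -> z != 0 ->
  \int[leb]_(t in `]0, T]) (expR (- (s * t)) * sin (z * t)) =
  z / (s ^+ 2 + z ^+ 2) -
  expR (- (s * T)) * (s * sin (z * T) + z * cos (z * T)) / (s ^+ 2 + z ^+ 2).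
Proof.
move=> T0 z0.
have sz : s ^+ 2 + z ^+ 2 != 0.
  by rewrite gt_eqF// ltr_wpDl ?sqr_ge0// exprn_even_gt0.
have cf : continuous (fun t : R => expR (- (s * t)) * sin (z * t)).
  move=> t; apply: cvgM.
    apply: (@continuous_comp _ _ _ (fun t => - (s * t)) expR); last exact: continuous_expR.
    by apply: cvgN; apply: cvgM => //; exact: cvg_cst.
  apply: (@continuous_comp _ _ _ (fun t => z * t) sin); last exact: continuous_sin.
  by apply: cvgM => //; exact: cvg_cst.
rewrite Rintegral_itv_obnd_cbnd; last first.
  apply: (@integrableS _ _ _ leb `[0, T]) => //.
    by apply: subset_itvr; rewrite bnd_simp.
  apply: continuous_compact_integrable; first exact: segment_compact.
  exact: continuous_subspaceT.
pose F t := - (expR (- (s * t)) * (s * sin (z * t) + z * cos (z * t))) /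
              (s ^+ 2 + z ^+ 2).
transitivity (F T - F 0); last first.
  by rewrite /F !mulr0 oppr0 expR0 sin0 cos0; field.
apply: (@Rintegral_FTC2 _ (fun t : R => expR (- (s * t)) * sin (z * t)) F) => //.
  by move=> t _; exact: is_derive_exp_sin.
by move=> t _; exact: cf.
Qed.

(** Once [1 / t] is replaced by an integral over [s] and the integrals are swapped, the inner one is
    explicit. Its boundary term at [t = 0] is [z / (s^2 + z^2)], of integral [pi / 2]; the one at
    [T] is the error [r]. *)
Lemma sine_integral_bound T z : 0 < T -> 0 < z ->
  `|sine_integral T z - pi / 2| <= 2 / (z * T).
Proof.
move=> T0 z0; have z0' : z != 0 by rewrite gt_eqF.
have sz s : 0 < s ^+ 2 + z ^+ 2 by rewrite ltr_wpDl ?sqr_ge0// exprn_gt0.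
pose f (p : R * R) := expR (- (p.2 * p.1)) * sin (z * p.1).
pose D1 : set R := [set` `]0, T]]; pose D2 : set R := [set` `[0, +oo[].
have mD1 : measurable D1 by exact: measurable_itv.
have mD2 : measurable D2 by exact: measurable_itv.
have mexp t : measurable_fun setT (fun s : R => expR (- (s * t))).
  apply: measurableT_comp => //; apply: measurableT_comp => //.
  exact: measurable_funM.
have iexp t : 0 < t -> leb.-integrable D2 (fun s => (expR (- (s * t)))%:E).
  move=> t0; apply/integrableP; split.
    by apply/measurable_EFinP/measurable_funTS; exact: mexp.
  under eq_integral do rewrite gee0_abs ?lee_fin ?expR_ge0//.
  by rewrite integral0y_expR// ltry.
have D1gt t : D1 t -> 0 < t by rewrite /D1/= in_itv/= => /andP[].
have mf : measurable_fun setT f.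
  apply: measurable_funM.
    apply: measurableT_comp => //; apply: measurableT_comp => //.
    by apply: measurable_funM.
  apply: (measurableT_comp measurable_sin).
  by apply: measurable_funM.
have f1 t : D1 t -> leb.-integrable D2 (fun s => (f (t, s))%:E).
  move=> /D1gt t0; rewrite /f/=.
  under eq_fun do rewrite mulrC EFinM.
  by apply: integrableZl => //; exact: iexp.
have f2 s : D2 s -> leb.-integrable D1 (fun t => (f (t, s))%:E).
  rewrite /D2/= in_itv/= andbT => s0.
  apply: (@bounded_integrable _ _ _ leb D1 _ _ 1 (fun t => f (t, s))) => //.
  - exact: lebesgue_itv_lty.
  - apply: measurable_funTS; exact: (measurableT_comp mf (pair2_measurable s)).
  - move=> t /D1gt t0; rewrite /f/= normrM mulr_ile1 ?sin_max//.
    by rewrite ger0_norm ?expR_ge0// -expR0 ler_expR oppr_le0 mulr_ge0// ltW.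
(* Integrating [s] out leaves [|sin (z t) / t| <= z], which has a finite integral because [t] stays
   below [T]. *)
have f12 : (\int[leb]_(t in D1) \int[leb]_(s in D2) `|f (t, s)|%:E < +oo)%E.
  apply: (@le_lt_trans _ _ (\int[leb]_(t in D1) (cst z%:E) t)%E); last first.
    by rewrite integral_cst// ltey_eq fin_numM// ge0_fin_numE// lebesgue_itv_lty.
  have E t : D1 t -> (\int[leb]_(s in D2) `|f (t, s)|%:E = `|sin (z * t) / t|%:E)%E.
    move=> /D1gt t0.
    transitivity (\int[leb]_(s in D2) (`|sin (z * t)|%:E * (expR (- (s * t)))%:E))%E.
      apply: eq_integral => s _; rewrite /f/= normrM EFinM muleC.
      by rewrite (ger0_norm (expR_ge0 _)).
    rewrite integralZl//; last exact: iexp.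
    by rewrite integral0y_expR// -EFinM normrM normfV (gtr0_norm t0).
  have -> : (\int[leb]_(t in D1) \int[leb]_(s in D2) `|f (t, s)|%:E =
      \int[leb]_(t in D1) `|sin (z * t) / t|%:E)%E.
    by apply: eq_integral => t /set_mem; exact: E.
  apply: ge0_le_integral => //.
  - apply/measurable_EFinP/measurableT_comp => //.
    by apply: measurable_funTS; exact: measurable_sinV.
  - move=> t _; rewrite lee_fin (le_trans (normr_sinV_le _ _))//.
    by rewrite gtr0_norm.
have SE : sine_integral T z = \int[leb]_(t in D1) \int[leb]_(s in D2) f (t, s).
  apply: eq_Rintegral => t /set_mem/D1gt t0; rewrite /f/=.
  under eq_Rintegral do rewrite mulrC.
  rewrite RintegralZl//; last exact: iexp.
  by rewrite /Rintegral integral0y_expR.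
rewrite SE Rintegral_swap//; last exact: measurable_funTS.
pose r s := expR (- (s * T)) * (s * sin (z * T) + z * cos (z * T)) / (s ^+ 2 + z ^+ 2).
have -> : \int[leb]_(s in D2) \int[leb]_(t in D1) f (t, s) =
    \int[leb]_(s in D2) (z / (s ^+ 2 + z ^+ 2) - r s).
  by apply: eq_Rintegral => s _; rewrite /f/= integral_expR_sin// ltW.
have msz : measurable_fun setT (fun s : R => (s ^+ 2 + z ^+ 2)^-1).
  apply: (measurableT_comp measurable_inv).
  by apply: measurable_funD => //; exact: measurable_funX.
have ic : leb.-integrable D2 (fun s => (z / (s ^+ 2 + z ^+ 2))%:E).
  apply/integrableP; split.
    by apply/measurable_EFinP/measurable_funTS; exact: measurable_funM.
  under eq_integral do rewrite gee0_abs ?lee_fin ?divr_ge0// ?(ltW z0)// ?(ltW (sz _))//.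
  by rewrite integral0y_cauchy// ltry.
(* The numerator is at most [s + z], and [z (s + z) <= 2 (s^2 + z^2)]. Integrating [exp (- s T)]
   then turns [2 / z] into [2 / (z T)]. *)
have rle s : D2 s -> `|r s| <= 2 / z * expR (- (s * T)).
  rewrite /D2/= in_itv/= andbT => s0.
  rewrite /r -mulrA normrM (ger0_norm (expR_ge0 _)) mulrC ler_wpM2r ?expR_ge0//.
  rewrite normf_div (gtr0_norm (sz _)) ler_pdivrMr//.
  rewrite (@le_trans _ _ (s + z))//.
    rewrite (le_trans (ler_normD _ _))// !normrM (ger0_norm s0) (gtr0_norm z0).
    by rewrite lerD// ler_piMr ?sin_max ?cos_max ?(ltW z0).
  rewrite -mulrA mulrC -mulrA ler_pdivlMl//.
  by nra.
have iexp2 : leb.-integrable D2 (fun s => (2 / z * expR (- (s * T)))%:E).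
  under eq_fun do rewrite EFinM.
  by apply: integrableZl => //; exact: iexp.
have ir : leb.-integrable D2 (EFin \o r).
  apply: (@le_integrable _ _ _ leb D2 _ _ (fun s => (2 / z * expR (- (s * T)))%:E)) => //.
  - apply/measurable_EFinP/measurable_funTS/measurable_funM => //.
    by apply: measurable_funM; [exact: mexp|apply: measurable_funD => //; exact: measurable_funM].
  - move=> s Ds; rewrite /= lee_fin (le_trans (rle _ Ds))//.
    exact: ler_norm.
rewrite RintegralB//.
rewrite [X in X - _ - _](_ : _ = pi / 2); last first.
  by rewrite /Rintegral integral0y_cauchy.
rewrite addrAC subrr add0r normrN (le_trans (le_normr_Rintegral _ ir))//.
have -> : 2 / (z * T) = \int[leb]_(s in D2) (2 / z * expR (- (s * T))).
  rewrite RintegralZl//; last exact: iexp.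
  by rewrite /Rintegral integral0y_expR//= invfM mulrA.
apply: le_Rintegral => //.
- exact: integrable_norm.
Qed.

Lemma sine_integralN T z : sine_integral T (- z) = - sine_integral T z.
Proof.
rewrite /sine_integral; under eq_Rintegral do rewrite mulNr sinN mulNr -mulN1r.
rewrite RintegralZl// ?mulN1r//.
apply: (@bounded_integrable _ _ _ leb `]0%R, T] _ _ `|z|) => //.
- exact: lebesgue_itv_lty.
- by apply: measurable_funTS; exact: measurable_sinV.
- by move=> t _; exact: normr_sinV_le.
Qed.

Lemma sine_integral0 T : sine_integral T 0 = 0.
Proof.
rewrite /sine_integral; under eq_Rintegral do rewrite mul0r sin0 mul0r.
by rewrite Rintegral_cst// mul0r.
Qed.

(** For [z T >= 1] the error bound [2 / (z T)] is at most [2]. For [z T < 1] the integrand is at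
    most [z] on an interval of length [T]. Negative frequencies follow by oddness. *)
Lemma normr_sine_integral_le T z : `|sine_integral T z| <= pi / 2 + 2.
Proof.
have pi0 : 0 < pi / 2 :> R by rewrite divr_gt0 ?pi_gt0.
have [T0|T0] := leP T 0.
  rewrite /sine_integral set_itv_ge ?bnd_simp -?leNgt// Rintegral_set0 normr0.
  by rewrite addr_ge0// ltW.
wlog z0 : z / 0 < z => [H|].
  have [z0|z0|<-] := ltgtP 0 z; first exact: H.
  - by rewrite -normrN -sine_integralN H// oppr_gt0.
  - by rewrite sine_integral0 normr0 addr_ge0// ltW.
have [zT|zT] := leP 1 (z * T).
  rewrite -[X in `|X|](subrK (pi / 2)) (le_trans (ler_normD _ _))//.
  rewrite (gtr0_norm pi0) addrC lerD2l (le_trans (sine_integral_bound _ _))//.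
  by rewrite ler_pdivrMr ?mulr_gt0// ler_pMr.
have := @le_norm_Rintegral _ _ _ leb `]0%R, T] _ _ `|z| (fun t => sin (z * t) / t).
rewrite fine_lebesgue_0T ?(ltW T0)// (gtr0_norm z0) => h.
rewrite (le_trans (h _ _ _ _))//.
- exact: lebesgue_itv_lty.
- by apply: measurable_funTS; exact: measurable_sinV.
- by move=> t _; rewrite (le_trans (normr_sinV_le _ _))// gtr0_norm.
- by lra.
Qed.

Lemma cvg_sine_integral z :
  sine_integral n%:R z @[n --> \oo] --> pi / 2 * Num.sg z.
Proof.
wlog z0 : z / 0 < z => [H|].
  have [z0|z0|<-] := ltgtP 0 z; first exact: H.
  - have := H (- z); rewrite oppr_gt0 => /(_ z0)/cvgN.
    rewrite sgrN mulrN opprK; apply: cvg_trans.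
    by rewrite (_ : (fun n => sine_integral _ z) =
      (fun n => - sine_integral n%:R (- z)))//; apply/funext => n;
      rewrite sine_integralN opprK.
  - rewrite sgr0 mulr0 (_ : (fun n => sine_integral _ _) = cst 0).
      exact: cvg_cst.
    by apply/funext => n; rewrite sine_integral0.
rewrite gtr0_sg// mulr1; apply/cvgrPdist_le => e e0.
near=> n; rewrite distrC.
have n0 : 0 < n%:R :> R by rewrite ltr0n; near: n; exact: nbhs_infty_gt.
rewrite (le_trans (sine_integral_bound n0 z0))//.
rewrite ler_pdivrMr ?mulr_gt0// mulrA -ler_pdivrMl ?mulr_gt0//.
by near: n; exact: nbhs_infty_ger.
Unshelve. all: by end_near. Qed.

End dirichlet.

(** * Laws on the line and their cosine transforms *)

Lemma probability_lty d (T : measurableType d) (R : realType)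
  (P : probability T R) (A : set T) : measurable A -> (P A < +oo)%E.
Proof. by move=> mA; rewrite (le_lt_trans (probability_le1 P mA))// ltry. Qed.

Section laws_on_R.
Context {R : realType}.
Notation law := (probability (measurableTypeR R) R).
Notation leb := (@lebesgue_measure R).
Implicit Types (m n : law) (f h : R -> R) (a t x y C : R).

Lemma law_integrable m f C : measurable_fun setT f -> (forall x, `|f x| <= C) ->
  m.-integrable setT (EFin \o f).
Proof.
move=> mf fC; apply: (@bounded_integrable _ _ _ m setT _ _ C) => //.
exact: probability_lty.
Qed.

Lemma law_Rintegral_cvg m (f_ : nat -> R -> R) f C :
  (forall k, measurable_fun setT (f_ k)) -> (forall k x, `|f_ k x| <= C) ->
  (forall x, f_ k x @[k --> \oo] --> f x) ->
  \int[m]_x f_ k x @[k --> \oo] --> \int[m]_x f x.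
Proof.
move=> mf fC ff.
by apply: (@bounded_Rintegral_cvg _ _ _ m setT _ _ C) => //; exact: probability_lty.
Qed.

Lemma law_Rintegral_cst m C : \int[m]_x C = C.
Proof.
rewrite Rintegral_cst// (_ : fine _ = 1) ?mulr1//.
exact: (congr1 fine (probability_setT m)).
Qed.

Lemma le_norm_law_Rintegral m f C : measurable_fun setT f ->
  (forall x, `|f x| <= C) -> `|\int[m]_x f x| <= C.
Proof.
move=> mf fC; have := @le_norm_Rintegral _ _ _ m setT measurableT _ C f mf.
rewrite (_ : fine _ = 1) ?mulr1; last exact: (congr1 fine (probability_setT m)).
apply => //.
exact: probability_lty.
Qed.

Lemma eq_law_Rintegral m n f : m ≡μ n -> \int[m]_x f x = \int[n]_x f x.
Proof.
by move=> mn; congr fine; apply: eq_measure_integral => A mA _; exact: mn.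
Qed.

Lemma law_eq_rays m n :
  (forall a, m `]a, +oo[%classic = n `]a, +oo[%classic) -> m ≡μ n.
Proof.
move=> mn A mA.
apply: (@measure_unique _ R (measurableTypeR R) (@RGenOInfty.G R)
  (fun k : nat => [set` `](- k%:R)%R, +oo[]) _ _ _ _ m n) => //.
- exact: RGenOInfty.measurableE.
- move=> _ _ [a ->] [b ->]; exists (Num.max a b).
  by apply/seteqP; split => x /=; rewrite !in_itv/= !andbT gt_max => /andP.
- by move=> k; exists (- k%:R).
- apply/seteqP; split => // x _.
  exists (Num.truncn `|x|).+1 => //=; rewrite in_itv/= andbT ltrNl.
  by rewrite (le_lt_trans (ler_norm _))// normrN truncnS_gt.
- by move=> _ [a ->]; exact: mn.
- by move=> k; exact: probability_lty.
Qed.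

Lemma law_eq_rays_Rintegral m n :
  (forall a, \int[m]_x \1_(`]a, +oo[%classic : set R) x =
             \int[n]_x \1_(`]a, +oo[%classic : set R) x) -> m ≡μ n.
Proof.
move=> mn; apply: law_eq_rays => a.
have E (k : law) : k `]a, +oo[%classic =
    (\int[k]_x \1_(`]a, +oo[%classic : set R) x)%:E.
  rewrite fineK integral_indic// setIT//.
  by rewrite fin_num_measure.
by rewrite !E mn.
Qed.

Lemma Rintegral_dilation a m f C : measurable_fun setT f ->
  (forall x, `|f x| <= C) ->
  \int[dilation a m]_x f x = \int[m]_x f (a * x).
Proof.
move=> mf fC; congr fine; apply: integral_distribution.
  exact/measurable_EFinP.
apply: (@law_integrable m (f \o *%R a) C) => //.
  by apply: measurableT_comp => //; exact: measurable_funM.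
by move=> x; exact: fC.
Qed.

Lemma Rintegral_symmetric m f C : symmetric_law m -> measurable_fun setT f ->
  (forall x, `|f x| <= C) -> \int[m]_x f (- x) = \int[m]_x f x.
Proof.
move=> sm mf fC; rewrite -(eq_law_Rintegral f sm) (Rintegral_dilation _ _ mf fC).
by apply: eq_Rintegral => x _; rewrite mulN1r.
Qed.

Let addb m n f : measurable_fun setT f -> forall C, (forall x, `|f x| <= C) ->
  (m \x n)%E.-integrable setT (EFin \o (f \o add_fun2)).
Proof.
move=> mf C fC; apply: (@bounded_integrable _ _ _ (m \x n)%E setT _ _ C) => //.
- exact: (@probability_lty _ _ _ (m \x n)%E).
- by apply: measurableT_comp => //; exact: measurable_add_fun2.
- by move=> p _; exact: fC.
Qed.

Lemma Rintegral_convolution m n f C : measurable_fun setT f ->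
  (forall x, `|f x| <= C) ->
  \int[convolution m n]_x f x = \int[m]_x \int[n]_y f (x + y).
Proof.
move=> mf fC; have ia := addb m n mf fC.
rewrite {1}/Rintegral integral_distribution//; last exact/measurable_EFinP.
rewrite -(integral12_prod_meas1 ia); congr fine; apply: eq_integral => x _.
rewrite fineK//; apply: integrable_fin_num => //.
apply: (@law_integrable n (fun y => f (x + y)) C) => //.
by apply: measurableT_comp => //; exact: measurable_funD.
Qed.

Lemma Rintegral_product_law m n f C : measurable_fun setT f ->
  (forall x, `|f x| <= C) ->
  \int[product_law m n]_x f x = \int[m]_x \int[n]_y f (x * y).
Proof.
move=> mf fC.
have ia : (m \x n)%E.-integrable setT (EFin \o (f \o mul_fun2)).
  apply: (@bounded_integrable _ _ _ (m \x n)%E setT _ _ C) => //.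
  - exact: (@probability_lty _ _ _ (m \x n)%E).
  - by apply: measurableT_comp => //; exact: measurable_mul_fun2.
  - by move=> p _; exact: fC.
rewrite {1}/Rintegral integral_distribution//; last exact/measurable_EFinP.
rewrite -(integral12_prod_meas1 ia); congr fine; apply: eq_integral => x _.
rewrite fineK//; apply: integrable_fin_num => //.
apply: (@law_integrable n (fun y => f (x * y)) C) => //.
by apply: measurableT_comp => //; exact: measurable_funM.
Qed.

(** The real part of the characteristic function, which for a symmetric law is all of it. *)
Definition cos_transform m (t : R) : R := \int[m]_x cos (t * x).

Lemma measurable_cosM t : measurable_fun setT (fun x : R => cos (t * x)).
Proof. by apply: (measurableT_comp measurable_cos); exact: measurable_funM. Qed.

Lemma measurable_sinM t : measurable_fun setT (fun x : R => sin (t * x)).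
Proof. by apply: (measurableT_comp measurable_sin); exact: measurable_funM. Qed.

Lemma cos_transform_dilation a m t :
  cos_transform (dilation a m) t = cos_transform m (t * a).
Proof.
rewrite /cos_transform (@Rintegral_dilation a m (fun x => cos (t * x)) 1)//.
- by apply: eq_Rintegral => x _; rewrite mulrA.
- exact: measurable_cosM.
- by move=> x; exact: cos_max.
Qed.

Lemma eq_cos_transform m n t : m ≡μ n -> cos_transform m t = cos_transform n t.
Proof. exact: eq_law_Rintegral. Qed.

Lemma cos_transformN m t : cos_transform m (- t) = cos_transform m t.
Proof. by apply: eq_Rintegral => x _; rewrite mulNr cosN. Qed.

Lemma cos_transform_abs m t : cos_transform m `|t| = cos_transform m t.
Proof. by have [//|t0] := ger0P t; rewrite cos_transformN. Qed.

Lemma cos_transform0 m : cos_transform m 0 = 1.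
Proof.
rewrite /cos_transform; under eq_Rintegral do rewrite mul0r cos0.
exact: law_Rintegral_cst.
Qed.

Lemma cos_transform_le1 m t : `|cos_transform m t| <= 1.
Proof.
by apply: le_norm_law_Rintegral; [exact: measurable_cosM|move=> x; exact: cos_max].
Qed.

Lemma sin_transform_symmetric m t : symmetric_law m -> \int[m]_x sin (t * x) = 0.
Proof.
move=> sm; have := Rintegral_symmetric sm (measurable_sinM t) (fun x => sin_max _).
under eq_Rintegral do rewrite mulrN sinN -mulN1r.
rewrite RintegralZl//; last first.
  by apply: (@law_integrable m (fun x => sin (t * x)) 1);
    [exact: measurable_sinM|move=> x; exact: sin_max].
by move=> h; lra.
Qed.

(** In the expansion of [cos (t x + t y)] the product of sines integrates to [0] as soon as one of
    the two laws is symmetric. *)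
Lemma cos_transform_convolution m n t : symmetric_law n ->
  cos_transform (convolution m n) t = cos_transform m t * cos_transform n t.
Proof.
move=> sn; rewrite /cos_transform (@Rintegral_convolution m n (fun x => cos (t * x)) 1)//; last 2 first.
  exact: measurable_cosM.
  by move=> x; exact: cos_max.
rewrite -RintegralZr//; last first.
  by apply: (@law_integrable m (fun x => cos (t * x)) 1);
    [exact: measurable_cosM|move=> x; exact: cos_max].
apply: eq_Rintegral => x _.
under eq_Rintegral do rewrite mulrDr cosD.
have ic : n.-integrable setT (EFin \o (fun y => cos (t * y))).
  by apply: (@law_integrable n (fun x => cos (t * x)) 1);
    [exact: measurable_cosM|move=> y; exact: cos_max].
have is_ : n.-integrable setT (EFin \o (fun y => sin (t * y))).
  by apply: (@law_integrable n (fun x => sin (t * x)) 1);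
    [exact: measurable_sinM|move=> y; exact: sin_max].
rewrite RintegralB//.
- by rewrite !RintegralZl// sin_transform_symmetric// mulr0 subr0.
- apply: (@law_integrable n (fun y => cos (t * x) * cos (t * y)) 1).
    by apply: measurable_funM => //; exact: measurable_cosM.
  by move=> y; rewrite normrM mulr_ile1// cos_max.
- apply: (@law_integrable n (fun y => sin (t * x) * sin (t * y)) 1).
    by apply: measurable_funM => //; exact: measurable_sinM.
  by move=> y; rewrite normrM mulr_ile1// sin_max.
Qed.

Lemma cos_transform_product_law m n t :
  cos_transform (product_law m n) t = \int[m]_x cos_transform n (t * x).
Proof.
rewrite /cos_transform (@Rintegral_product_law m n (fun x => cos (t * x)) 1); last 2 first.
  exact: measurable_cosM.
  by move=> x; exact: cos_max.
by apply: eq_Rintegral => x _; apply: eq_Rintegral => y _; rewrite mulrA.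
Qed.

Lemma continuous_cos_transform m : continuous (cos_transform m).
Proof.
move=> t; apply/(@cvg_nbhsP _ R^o) => u ut.
apply: (@law_Rintegral_cvg m (fun k x => cos (u k * x)) (fun x => cos (t * x)) 1).
- by move=> k; exact: measurable_cosM.
- by move=> k x; exact: cos_max.
- move=> x; apply: (@cvg_comp _ _ _ (fun k => u k * x) cos _ (nbhs (t * x))).
    by apply: cvgM => //; exact: cvg_cst.
  exact: continuous_cos.
Qed.

Lemma symmetric_convolution m n :
  symmetric_law m -> symmetric_law n -> symmetric_law (convolution m n).
Proof.
move=> sm sn; apply: law_eq_rays_Rintegral => a; set f := \1__.
have mf : measurable_fun setT f by exact: measurable_indic.
have f1 x : `|f x| <= 1 by rewrite /f indicE; case: (_ \in _); rewrite ?normr1 ?normr0.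
have mN (h : R -> R) b : measurable_fun setT h -> measurable_fun setT (fun x => h (b * x)).
  by move=> mh; apply: measurableT_comp => //; exact: measurable_funM.
have mA (h : R -> R) b : measurable_fun setT h -> measurable_fun setT (fun x => h (b + x)).
  by move=> mh; apply: measurableT_comp => //; exact: measurable_funD.
rewrite (Rintegral_dilation _ _ mf f1) (Rintegral_convolution _ _ mf f1).
rewrite (Rintegral_convolution _ _ (mN _ _ mf) (fun x => f1 (-1 * x))).
transitivity (\int[m]_x \int[n]_y f (- x + y)).
  apply: eq_Rintegral => x _.
  rewrite -(Rintegral_symmetric sn (mA _ (- x) mf) (fun y => f1 _)).
  by apply: eq_Rintegral => y _; rewrite mulN1r opprD.
pose F x := \int[n]_y f (x + y).
change (\int[m]_x F (- x) = \int[m]_x F x).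
apply: (@Rintegral_symmetric _ F 1) => //; last first.
  by move=> x; apply: le_norm_law_Rintegral => //; exact: mA.
(* The measurability of [F] is read off from its integrability, a by-product of Fubini. *)
have : m.-integrable setT (EFin \o F).
  apply: (@bounded_integrable_Rintegral _ _ _ _ _ m n setT setT _ _ _ _ (f \o add_fun2) 1) => //.
  - exact: probability_lty.
  - exact: probability_lty.
  - by rewrite setXTT; apply: measurableT_comp => //; exact: measurable_add_fun2.
  - by move=> x y _ _; exact: f1.
by move/measurable_int/measurable_EFinP.
Qed.

Lemma symmetric_product_law m n :
  symmetric_law n -> symmetric_law (product_law m n).
Proof.
move=> sn; apply: law_eq_rays_Rintegral => a; set f := \1__.
have mf : measurable_fun setT f by exact: measurable_indic.
have f1 x : `|f x| <= 1 by rewrite /f indicE; case: (_ \in _); rewrite ?normr1 ?normr0.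
have mN (h : R -> R) b : measurable_fun setT h -> measurable_fun setT (fun x => h (b * x)).
  by move=> mh; apply: measurableT_comp => //; exact: measurable_funM.
rewrite (Rintegral_dilation _ _ mf f1) (Rintegral_product_law _ _ mf f1).
rewrite (Rintegral_product_law _ _ (mN _ _ mf) (fun x => f1 (-1 * x))).
apply: eq_Rintegral => x _.
rewrite -(Rintegral_symmetric sn (mN _ x mf) (fun y => f1 _)).
by apply: eq_Rintegral => y _; rewrite mulN1r mulrN.
Qed.

Lemma symmetric_dilation a m : symmetric_law m -> symmetric_law (dilation a m).
Proof.
move=> sm; apply: law_eq_rays_Rintegral => b; set f := \1__.
have mf : measurable_fun setT f by exact: measurable_indic.
have f1 x : `|f x| <= 1 by rewrite /f indicE; case: (_ \in _); rewrite ?normr1 ?normr0.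
have mN (h : R -> R) c : measurable_fun setT h -> measurable_fun setT (fun x => h (c * x)).
  by move=> mh; apply: measurableT_comp => //; exact: measurable_funM.
rewrite !(Rintegral_dilation _ _ mf f1) (Rintegral_dilation _ _ (mN _ _ mf) (fun x => f1 _)).
rewrite -(Rintegral_symmetric sm (mN _ a mf) (fun y => f1 _)).
by apply: eq_Rintegral => y _; rewrite mulrN mulN1r.
Qed.

End laws_on_R.

(** * Inversion of the cosine transform of a symmetric law *)

Section cosine_inversion.
Context {R : realType}.
Notation law := (probability (measurableTypeR R) R).
Notation leb := (@lebesgue_measure R).
Implicit Types (m n : law) (a b t x y T : R).

Lemma measurable_sg : measurable_fun setT (@Num.sg R).
Proof.
have -> : @Num.sg R = (fun x => \1_(`]0, +oo[%classic : set R) x - \1_(`]-oo, 0[%classic : set R) x).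
  apply/funext => x; rewrite !indicE !mem_setE !in_itv/= andbT.
  by case: sgrP; rewrite ?subr0 ?sub0r ?subrr.
by apply: measurable_funB; exact: measurable_indic.
Qed.

(** Its mean under a law is the truncated integral of the cosine transform against [sin (a t) / t].
    For [a > 0] it tends to [pi / 2] if [|x| < a], to [pi / 4] if [|x| = a] and to [0] otherwise. *)
Definition dirichlet_kernel T a x : R :=
  \int[leb]_(t in `]0, T]) (cos (t * x) * (sin (a * t) / t)).

Let mker a : measurable_fun setT
  (fun p : R * R => cos (p.2 * p.1) * (sin (a * p.2) / p.2)).
Proof.
apply: measurable_funM.
  by apply: (measurableT_comp measurable_cos); exact: measurable_funM.
exact: (measurableT_comp (measurable_sinV a) measurable_snd).
Qed.

Let ker_le a x t : `|cos (t * x) * (sin (a * t) / t)| <= `|a|.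
Proof.
by rewrite normrM (le_trans _ (normr_sinV_le a t))// ler_piMl ?cos_max.
Qed.

Lemma dirichlet_kernelE T a x : dirichlet_kernel T a x =
  2^-1 * (sine_integral T (a + x) + sine_integral T (a - x)).
Proof.
have i b : leb.-integrable `]0, T] (EFin \o (fun t => sin (b * t) / t)).
  apply: (@bounded_integrable _ _ _ leb _ _ _ `|b|) => //.
  - exact: lebesgue_itv_lty.
  - by apply: measurable_funTS; exact: measurable_sinV.
  - by move=> t _; exact: normr_sinV_le.
rewrite /sine_integral -RintegralD// -RintegralZl//.
  apply: eq_Rintegral => t _; rewrite !mulrDl mulNr sinD sinB (mulrC x t).
  (* Abstracting the inverse spares [field] the side condition that [t] is nonzero. *)
  by move: (t^-1) => u; field.
exact: (integrableD _ (i _) (i _)).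
Qed.

Lemma normr_dirichlet_kernel_le T a x : `|dirichlet_kernel T a x| <= pi / 2 + 2.
Proof.
rewrite dirichlet_kernelE normrM ger0_norm ?invr_ge0//.
rewrite ler_pdivrMl// (le_trans (ler_normD _ _))//.
have := normr_sine_integral_le T (a + x).
have := normr_sine_integral_le T (a - x).
by lra.
Qed.

Lemma cvg_dirichlet_kernel a x : dirichlet_kernel n%:R a x @[n --> \oo] -->
  pi / 4 * (Num.sg (a + x) + Num.sg (a - x)).
Proof.
have -> : pi / 4 * (Num.sg (a + x) + Num.sg (a - x)) =
    2^-1 * (pi / 2 * Num.sg (a + x) + pi / 2 * Num.sg (a - x)) :> R by field.
under eq_fun do rewrite dirichlet_kernelE.
apply: cvgM; first exact: cvg_cst.
by apply: cvgD; exact: cvg_sine_integral.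
Qed.

Let law_kernel_integrable m T a : m.-integrable setT (EFin \o dirichlet_kernel T a).
Proof.
apply: (@bounded_integrable_Rintegral _ _ _ _ _ m leb setT `]0%R, T]%classic _ _ _ _
  (fun p : R * R => cos (p.2 * p.1) * (sin (a * p.2) / p.2)) `|a|) => //.
- exact: probability_lty.
- exact: lebesgue_itv_lty.
- by apply: measurable_funTS; exact: mker.
Qed.

Lemma law_dirichlet_kernel m T a : \int[m]_x dirichlet_kernel T a x =
  \int[leb]_(t in `]0, T]) (cos_transform m t * (sin (a * t) / t)).
Proof.
rewrite (@bounded_Rintegral_swap _ _ _ _ _ m leb setT `]0%R, T]%classic _ _ _ _
  (fun p : R * R => cos (p.2 * p.1) * (sin (a * p.2) / p.2)) `|a|) => //.
- apply: eq_Rintegral => t _ /=; rewrite RintegralZr//.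
  by apply: (@law_integrable _ m (fun x => cos (t * x)) 1);
    [exact: measurable_cosM|move=> x; exact: cos_max].
- exact: probability_lty.
- exact: lebesgue_itv_lty.
- by apply: measurable_funTS; exact: mker.
Qed.

Let sgb (x : R) : `|Num.sg x| <= 1.
Proof. by rewrite normr_sg; case: (_ != _). Qed.

Let msgB a : measurable_fun setT (fun x => Num.sg (a - x)).
Proof. by apply: (measurableT_comp measurable_sg); exact: measurable_funB. Qed.

Let msgD a : measurable_fun setT (fun x => Num.sg (a + x)).
Proof. by apply: (measurableT_comp measurable_sg); exact: measurable_funD. Qed.

(** By symmetry [sg (a + x)] and [sg (a - x)] have the same mean, which merges the two halves of the
    limiting kernel. *)
Lemma symmetric_cvg_sg m a : symmetric_law m ->
  \int[leb]_(t in `]0, k%:R]) (cos_transform m t * (sin (a * t) / t)) @[k --> \oo] -->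
  pi / 2 * \int[m]_x Num.sg (a - x).
Proof.
move=> sm; under eq_fun do rewrite -law_dirichlet_kernel.
have iB : m.-integrable setT (EFin \o (fun x => Num.sg (a - x))).
  by apply: (@law_integrable _ m (fun x => Num.sg (a - x)) 1) => // x; exact: sgb.
have iD : m.-integrable setT (EFin \o (fun x => Num.sg (a + x))).
  by apply: (@law_integrable _ m (fun x => Num.sg (a + x)) 1) => // x; exact: sgb.
have -> : pi / 2 * \int[m]_x Num.sg (a - x) =
    \int[m]_x (pi / 4 * (Num.sg (a + x) + Num.sg (a - x))).
  rewrite RintegralZl//; last exact: (integrableD _ iD iB).
  rewrite RintegralD//.
  rewrite -(@Rintegral_symmetric _ m (fun x => Num.sg (a + x)) 1)//.
  by field.
apply: (@law_Rintegral_cvg _ m (fun k x => dirichlet_kernel k%:R a x)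
  (fun x => pi / 4 * (Num.sg (a + x) + Num.sg (a - x))) (pi / 2 + 2)).
- by move=> k; have /measurable_int/measurable_EFinP := law_kernel_integrable m k%:R a.
- by move=> k x; exact: normr_dirichlet_kernel_le.
- by move=> x; exact: cvg_dirichlet_kernel.
Qed.

(** Approaching [a] strictly from the right removes the value [0] of the sign at [x = a], that is,
    the half-counted atom at [a]. *)
Let cvg_sg_right a x : Num.sg (a + k.+1%:R^-1 - x) @[k --> \oo] -->
  (1 - 2 * \1_(`]a, +oo[%classic : set R) x : R).
Proof.
rewrite indicE mem_setE in_itv/= andbT; case: ltP => ax.
  have d0 : 0 < x - a by rewrite subr_gt0.
  apply: cvg_near_cst; near=> k.
  rewrite ltr0_sg; first by rewrite mulr1; lra.
  rewrite subr_lt0 -ltrBrDl.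
  by near: k; exact: (near_infty_natSinv_lt (PosNum d0)).
rewrite mulr0 subr0; apply: cvg_near_cst; apply: nearW => k.
by rewrite gtr0_sg// subr_gt0 (le_lt_trans ax)// ltrDl invr_gt0.
Unshelve. all: by end_near. Qed.

(** The transform determines the mean of [sg (b - x)] for every [b], which is the mass below [b]
    minus the mass above it. Letting [b] decrease to [a] recovers the mass of the ray []a, +oo[]. *)
Theorem cos_transform_inj m n : symmetric_law m -> symmetric_law n ->
  (forall t, 0 <= t -> cos_transform m t = cos_transform n t) -> m ≡μ n.
Proof.
move=> sm sn mn; apply: law_eq_rays_Rintegral => a.
have E b : \int[m]_x Num.sg (b - x) = \int[n]_x Num.sg (b - x).
  have pi0 : pi / 2 != 0 :> R by rewrite mulf_neq0 ?invr_neq0// gt_eqF ?pi_gt0.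
  apply: (@mulfI R (pi / 2)) => //.
  have cm := @symmetric_cvg_sg m b sm; have cn := @symmetric_cvg_sg n b sn.
  apply: (cvg_unique (@Rhausdorff R) cm); apply: cvg_trans cn.
  apply: near_eq_cvg; apply: nearW => k; apply: eq_Rintegral => t.
  by rewrite inE/= in_itv/= => /andP[t0 _]; rewrite mn// ltW.
have L (l : law) : \int[l]_x Num.sg (a + k.+1%:R^-1 - x) @[k --> \oo] -->
    (1 - 2 * \int[l]_x \1_(`]a, +oo[%classic : set R) x : R).
  have -> : 1 - 2 * \int[l]_x \1_(`]a, +oo[%classic : set R) x =
      \int[l]_x (1 - 2 * \1_(`]a, +oo[%classic : set R) x).
    have i1 : l.-integrable setT (EFin \o \1_(`]a, +oo[%classic : set R)).
      apply: (@law_integrable _ l _ 1); first exact: measurable_indic.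
      by move=> x; rewrite indicE; case: (_ \in _); rewrite ?normr1 ?normr0.
    rewrite RintegralB//; last 2 first.
    - by apply: (@law_integrable _ l (cst 1) 1) => // x; rewrite normr1.
    - exact: (integrableZl measurableT 2 i1).
    by rewrite law_Rintegral_cst RintegralZl.
  apply: (@law_Rintegral_cvg _ l (fun k x => Num.sg (a + k.+1%:R^-1 - x))
    (fun x => 1 - 2 * \1_(`]a, +oo[%classic : set R) x) 1) => // k x; exact: sgb.
suff : 1 - 2 * \int[m]_x \1_(`]a, +oo[%classic : set R) x =
       1 - 2 * \int[n]_x \1_(`]a, +oo[%classic : set R) x by lra.
apply: (cvg_unique (@Rhausdorff R) (L m)); apply: cvg_trans (L n).
by apply: near_eq_cvg; apply: nearW => k; rewrite E.
Qed.

End cosine_inversion.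

(** * The law of density [kendall_pdf] and its cosine transform *)

Section kendall_density.
Context {R : realType}.
Notation leb := (@lebesgue_measure R).
Implicit Types (t x y v T : R).
Variable al : R.
Hypotheses (al_gt0 : 0 < al) (al_le1 : al <= 1).

Let al0 : al != 0. Proof. by rewrite gt_eqF. Qed.

Lemma continuous_powR_gt0 b x : 0 < x -> {for x, continuous (fun y : R => y `^ b)}.
Proof. by move=> x0; apply: is_derive_continuous (is_derive1_powR b x0). Qed.

(** The bound [|sin x| <= x] absorbs the singularity of the power at [0]. *)
Lemma powR_sin_le x : 0 <= x -> `|x `^ (al - 1) * sin x| <= x `^ al.
Proof.
move=> x0; rewrite normrM (ger0_norm (powR_ge0 _ _)).
rewrite -(mulr_powRB1 x0 al_gt0) mulrC ler_wpM2r ?powR_ge0//.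
by rewrite (le_trans (normr_sin_le x))// ger0_norm.
Qed.

Lemma measurable_powR_sin : measurable_fun setT (fun x => x `^ (al - 1) * sin x).
Proof. by apply: measurable_funM; [exact: measurable_powR|exact: measurable_sin]. Qed.

Let continuous_powR_sin x : 0 < x ->
  {for x, continuous (fun y : R => y `^ (al - 1) * sin y)}.
Proof.
move=> x0; apply: cvgM; first exact: continuous_powR_gt0.
exact: continuous_sin.
Qed.

Let powR_sin_cvg0 : x `^ (al - 1) * sin x @[x --> 0^'+] --> (0 : R).
Proof.
apply/cvgrPdist_le => e e0.
have /cvgrPdist_le/(_ _ e0) h := powR_cvg0 al_gt0.
near=> x; rewrite sub0r normrN.
have x0 : 0 < x by near: x; exact: nbhs_right_gt.
rewrite (le_trans (powR_sin_le (ltW x0)))//.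
have : `|0 - x `^ al| <= e by near: x.
by rewrite sub0r normrN ger0_norm ?powR_ge0.
Unshelve. all: by end_near. Qed.

Let within_continuous_powR_sin T : 0 < T ->
  {within `[0, T], continuous (fun y : R => y `^ (al - 1) * sin y)}.
Proof.
move=> T0; apply/continuous_within_itvP => //; split.
- by move=> x; rewrite in_itv/= => /andP[x0 _]; exact: continuous_powR_sin.
- by rewrite sin0 mulr0; exact: powR_sin_cvg0.
- by apply: cvg_at_left_filter; exact: continuous_powR_sin.
Qed.

Let powR_sin_integrable T :
  leb.-integrable `[0, T] (fun y => (y `^ (al - 1) * sin y)%:E).
Proof.
apply: (@bounded_integrable _ _ _ leb _ _ _ (T `^ al) (fun y => y `^ (al - 1) * sin y)) => //.
- exact: lebesgue_itv_lty.
- by apply: measurable_funTS; exact: measurable_powR_sin.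
- move=> x /=; rewrite in_itv/= => /andP[x0 xT].
  rewrite (le_trans (powR_sin_le x0))// ge0_ler_powR ?nnegrE ?(ltW al_gt0)//.
  exact: le_trans xT.
Qed.

Definition sine_moment T : R :=
  \int[leb]_(x in `[0, T]) (x `^ (al - 1) * sin x).

Lemma is_derive_sine_moment x : 0 < x ->
  is_derive x 1 sine_moment (x `^ (al - 1) * sin x).
Proof.
move=> x0.
have [|d dE] := @continuous_FTC1_closed _ (fun y => y `^ (al - 1) * sin y) 0 x (x + 1) _
  (powR_sin_integrable _) x0 (continuous_powR_sin x0); first by rewrite ltrDl.
by split; [exact: d|rewrite -derive1E; exact: dE].
Qed.

(** Under [x = T v^(1/al)] one has [al x^(al - 1) dx = T^al dv], so the power weight disappears and
    the moment becomes an average of sines over uniform [v]. *)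
Lemma sine_moment_scale T : 0 < T ->
  al * sine_moment T = T `^ al * \int[leb]_(v in `]0, 1]) sin (T * v `^ al^-1).
Proof.
move=> T0.
have ai0 : 0 < al^-1 by rewrite invr_gt0.
pose F v : R := T * v `^ al^-1.
have dF v : 0 < v -> is_derive v 1 F (T * (al^-1 * v `^ (al^-1 - 1))).
  move=> v0; have := @is_derive1_powR R al^-1 v v0 => d.
  by apply: is_derive_eq; rewrite /GRing.scale/= ; ring.
have dF1 v : 0 < v -> F^`()%classic v = T * (al^-1 * v `^ (al^-1 - 1)).
  by move=> v0; rewrite derive1E; have [_] := dF v v0.
pose d v := T * (al^-1 * v `^ (al^-1 - 1)).
have cF' v : 0 < v -> {for v, continuous F^`()%classic}.
  move=> v0; rewrite /prop_for/= /continuous_at dF1//.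
  have cd : d w @[w --> v] --> d v.
    apply: cvgM; first exact: cvg_cst.
    apply: cvgM; first exact: cvg_cst.
    exact: continuous_powR_gt0.
  apply: cvg_trans cd; apply: near_eq_cvg; near=> w; rewrite dF1//.
  by near: w; exact: lt_nbhsr.
have cF v : 0 < v -> {for v, continuous F}.
  by move=> v0; exact: is_derive_continuous (dF v v0).
have F0 : F 0 = 0 by rewrite /F powR0 ?mulr0// gt_eqF.
have F1 : F 1 = T by rewrite /F powR1 mulr1.
have cF0 : F x @[x --> 0^'+] --> F 0.
  rewrite F0 -[X in _ --> X](mulr0 T); apply: cvgM; first exact: cvg_cst.
  exact: powR_cvg0.
have sub := @integration_by_substitution_increasing R F
  (fun y => y `^ (al - 1) * sin y) 0 1 ler01.
rewrite F0 F1 in sub.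
have mF : measurable_fun setT (fun v => sin (F v)).
  apply: (measurableT_comp measurable_sin).
  by apply: measurable_funM => //; exact: measurable_powR.
have gE : {in (`]0, 1]%classic : set R), (fun v => (al^-1 * T `^ al * sin (F v))%:E) =1
    (fun v => ((((fun y => y `^ (al - 1) * sin y) \o F) * F^`()%classic) v)%:E)}.
  move=> v; rewrite inE/= in_itv/= => /andP[v0 v1]; congr EFin.
  rewrite [RHS]/GRing.mul/= dF1// {2 3}/F powRM ?powR_ge0 ?(ltW T0)// -powRrM.
  rewrite -(mulr_powRB1 (ltW T0) al_gt0).
  have -> : v `^ (al^-1 - 1) = (v `^ (al^-1 * (al - 1)))^-1.
    by rewrite -powRN; congr (_ `^ _); field.
  have vp : v `^ (al^-1 * (al - 1)) != 0 by rewrite gt_eqF ?powR_gt0.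
  by field; rewrite al0 vp.
have E : (\int[leb]_(x in `[0%R, T]) (x `^ (al - 1) * sin x)%:E =
    \int[leb]_(v in `]0%R, 1%R]) (al^-1 * T `^ al * sin (F v))%:E)%E.
  rewrite sub//.
  - rewrite -integral_itv_obnd_cbnd; first by apply: eq_integral => v /gE.
    apply: (eq_measurable_fun _ gE).
    by apply/measurable_EFinP/measurable_funTS/measurable_funM.
  - move=> x y; rewrite !in_itv/= => /andP[x0 _] /andP[y0 _] xy.
    by rewrite ltr_pM2l// gt0_ltr_powR.
  - move=> v; rewrite in_itv/= => /andP[v0 _]; exact: cF'.
  - have -> : F^`()%classic x @[x --> 0^'+] = d x @[x --> 0^'+].
      apply/seteqP; split; apply: near_eq_cvg; near=> v; rewrite dF1//;
        near: v; exact: nbhs_right_gt.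
    apply: is_cvgM; first exact: is_cvg_cst.
    apply: is_cvgM; first exact: is_cvg_cst.
    (* Here [al <= 1] keeps the derivative of the substitution bounded at [0]. For [al = 1] the
       exponent is [0] and the power is constantly [1]. *)
    have : 0 <= al^-1 - 1 by rewrite subr_ge0 invf_ge1.
    rewrite le_eqVlt => /predU1P[<-|a1].
      by under eq_fun do rewrite powRr0; exact: is_cvg_cst.
    by apply/cvg_ex; exists 0; exact: powR_cvg0.
  - by apply/cvg_ex; eexists; apply: cvg_at_left_filter; exact: cF'.
  - split => //.
    + by move=> v; rewrite in_itv/= => /andP[v0 _]; have [] := dF v v0.
    + by apply: cvg_at_left_filter; exact: cF.
  - exact: within_continuous_powR_sin.
have -> : sine_moment T = \int[leb]_(v in `]0, 1]) (al^-1 * T `^ al * sin (F v)).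
  by congr fine; exact: E.
rewrite RintegralZl//; first by rewrite !mulrA mulfV// mul1r.
apply: (@bounded_integrable _ _ _ leb _ _ _ 1 (fun v => sin (F v))) => //.
- exact: lebesgue_itv_lty.
- exact: measurable_funTS.
- by move=> v _; exact: sin_max.
Unshelve. all: by end_near. Qed.

Lemma sine_moment_le T : 0 <= T -> `|sine_moment T| <= T `^ al * T.
Proof.
move=> T0; rewrite [leRHS](_ : _ = T `^ al * fine (leb `[0, T])); last first.
  rewrite lebesgue_measure_itv/= lte_fin; case: ltP => /= [_|T0'].
    by rewrite oppr0 addr0.
  by congr (_ * _); apply/eqP; rewrite eq_le T0 T0'.
apply: le_norm_Rintegral => //.
- exact: lebesgue_itv_lty.
- by apply: measurable_funTS; exact: measurable_powR_sin.
- move=> x /=; rewrite in_itv/= => /andP[x0 xT].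
  rewrite (le_trans (powR_sin_le x0))// ge0_ler_powR ?nnegrE ?(ltW al_gt0)//.
Qed.

Lemma onem_cos_le x : 0 <= x -> 1 - cos x <= x.
Proof.
move=> x0.
have [c _] : exists2 c, c \in `[0, x] & cos x - cos 0 = - sin c * (x - 0).
  apply: MVT_segment => //.
  by apply: continuous_subspaceT; exact: continuous_cos.
by rewrite cos0 subr0 => h; rewrite -opprB h mulNr opprK ler_piMl// sin_le1.
Qed.

(** Integrating by parts with the antiderivative [1 - cos x] of [sin x] gives the boundary term
    [T^(al - 1) (1 - cos T)] plus [1 - al] times the integral of [x^(al - 2) (1 - cos x)], both
    nonnegative. Here this is the monotonicity of [G]. *)
Lemma sine_moment_ge0 T : 0 < T -> 0 <= sine_moment T.
Proof.
move=> T0; pose G x := sine_moment x - x `^ (al - 1) * (1 - cos x).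
have dG x : 0 < x -> is_derive x 1 G ((1 - al) * x `^ (al - 1 - 1) * (1 - cos x)).
  move=> x0; have d1 := is_derive_sine_moment x0.
  have d2 := @is_derive1_powR R (al - 1) x x0.
  by apply: is_derive_eq; rewrite /GRing.scale/=; ring.
(* The derivative of [G] is controlled only away from [0], so the mean value theorem is applied on
   [[e, T]]. The two summands bound the two terms of [G e] and vanish with [e]. *)
have lower e : 0 < e -> e < T -> - (e `^ al * e + e `^ al) <= sine_moment T.
  move=> e0 eT.
  have [c ceT GE] : exists2 c, c \in `[e, T] &
      G T - G e = (1 - al) * c `^ (al - 1 - 1) * (1 - cos c) * (T - e).
    apply: MVT_segment; first exact: ltW.
    - by move=> x; rewrite in_itv/= => /andP[ex _]; apply: dG; exact: lt_trans ex.
    - apply: continuous_in_subspaceT => x; rewrite inE/= in_itv/= => /andP[ex _].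
      exact: (is_derive_continuous (dG x (lt_le_trans e0 ex))).
  have GT : G e <= G T.
    rewrite -subr_ge0 GE !mulr_ge0 ?powR_ge0 ?subr_ge0 ?cos_le1//.
    exact: ltW.
  have h1 : 0 <= T `^ (al - 1) * (1 - cos T).
    by rewrite mulr_ge0 ?powR_ge0// subr_ge0 cos_le1.
  have h2 : e `^ (al - 1) * (1 - cos e) <= e `^ al.
    rewrite -(mulr_powRB1 (ltW e0) al_gt0) mulrC ler_wpM2r ?powR_ge0//.
    exact/onem_cos_le/ltW.
  have /ler_normlP[h3 _] := sine_moment_le (ltW e0).
  move: GT h1 h2 h3; rewrite /G.
  by lra.
have c0 : - (e `^ al * e + e `^ al) @[e --> (0:R)^'+] --> (0:R).
  rewrite -[X in _ --> X]oppr0 -[X in _ --> - X]addr0; apply: cvgN; apply: cvgD.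
    rewrite -[X in _ --> X](mul0r (0:R)); apply: cvgM; first exact: powR_cvg0.
    by apply: cvg_at_right_filter; exact: cvg_id.
  exact: powR_cvg0.
rewrite -(cvg_lim (@Rhausdorff R) c0); apply: limr_le; first by apply: cvgP c0.
near=> e; apply: lower; first by near: e; exact: nbhs_right_gt.
by near: e; exact: nbhs_right_lt.
Unshelve. all: by end_near. Qed.

Local Notation pdf := (kendall_pdf al).

Lemma kendall_pdf_moment t :
  pdf t = al / pi * `|t| `^ (- al - 1) * sine_moment `|t|.
Proof. by []. Qed.

Lemma kendall_pdfN t : pdf (- t) = pdf t.
Proof. by rewrite /kendall_pdf normrN. Qed.

Lemma kendall_pdf0 : pdf 0 = 0.
Proof.
rewrite /kendall_pdf normr0 powR0 ?mulr0 ?mul0r//.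
by rewrite -opprD oppr_eq0 gt_eqF// addr_gt0.
Qed.

Lemma kendall_pdf_ge0 t : 0 <= pdf t.
Proof.
have [->|t0] := eqVneq t 0; first by rewrite kendall_pdf0.
rewrite kendall_pdf_moment !mulr_ge0 ?powR_ge0 ?invr_ge0 ?pi_ge0 ?(ltW al_gt0)//.
by rewrite sine_moment_ge0// normr_gt0.
Qed.

Lemma measurable_kendall_pdf : measurable_fun setT pdf.
Proof.
(* The moment is differentiable, hence continuous, on the open half-line. Cutting it off at [0] is
   harmless, since the power in front of it vanishes there. *)
pose F : R -> R := sine_moment \_ `]0, +oo[.
have mF : measurable_fun setT F.
  apply/(measurable_restrictT _ _).1 => //.
  apply: open_continuous_measurable_fun; first exact: interval_open.
  move=> x; rewrite inE/= in_itv/= andbT => x0.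
  exact: (is_derive_continuous (is_derive_sine_moment x0)).
have -> : pdf = fun t => al / pi * `|t| `^ (- al - 1) * F `|t|.
  apply/funext => t; have [->|t0] := eqVneq t 0.
    rewrite kendall_pdf0 normr0 powR0 ?mulr0 ?mul0r//.
    by rewrite -opprD oppr_eq0 gt_eqF// addr_gt0.
  by rewrite kendall_pdf_moment /F patchE mem_set//= in_itv/= andbT normr_gt0.
apply: measurable_funM.
  apply: measurable_funM => //.
  by apply: (measurableT_comp (@measurable_powR R (- al - 1))) => //; exact: normr_measurable.
by apply: (measurableT_comp mF); exact: normr_measurable.
Qed.

Lemma kendall_pdfE t : 0 < t ->
  pdf t = pi^-1 * \int[leb]_(v in `]0, 1]) (sin (v `^ al^-1 * t) / t).
Proof.
move=> t0; rewrite kendall_pdf_moment gtr0_norm//.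
have t0' : t != 0 by rewrite gt_eqF.
have -> : al / pi * t `^ (- al - 1) * sine_moment t =
    pi^-1 * t `^ (- al - 1) * (al * sine_moment t) by ring.
rewrite sine_moment_scale//.
have -> : pi^-1 * t `^ (- al - 1) *
    (t `^ al * \int[leb]_(v in `]0, 1]) sin (t * v `^ al^-1)) =
  pi^-1 * (\int[leb]_(v in `]0, 1]) sin (t * v `^ al^-1) * (t `^ (- al - 1) * t `^ al)).
  by ring.
rewrite -powRD ?t0' ?implybT// (_ : - al - 1 + al = -1); last by ring.
rewrite powR_inv1 ?(ltW t0)// -RintegralZr//.
  by congr (_ * _); apply: eq_Rintegral => v _; rewrite (mulrC t).
apply: (@bounded_integrable _ _ _ leb _ _ _ 1 (fun v => sin (t * v `^ al^-1))) => //.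
- exact: lebesgue_itv_lty.
- apply: measurable_funTS; apply: (measurableT_comp measurable_sin).
  by apply: measurable_funM => //; exact: measurable_powR.
- by move=> v _; exact: sin_max.
Qed.

End kendall_density.

Definition kendall_cf {R : realType} (al x : R) : R := Num.max 0 (1 - `|x| `^ al).

(** * Truncated cosine transforms of the density *)

Section kendall_transform.
Context {R : realType}.
Notation leb := (@lebesgue_measure R).
Implicit Types (t x y v T : R).
Variable al : R.
Hypotheses (al_gt0 : 0 < al) (al_le1 : al <= 1).
Local Notation pdf := (kendall_pdf al).
Local Notation cf := (kendall_cf al).

Let al0 : al != 0. Proof. by rewrite gt_eqF. Qed.
Let ai_gt0 : 0 < al^-1. Proof. by rewrite invr_gt0. Qed.

Let in01 v : v \in (`]0, 1]%classic : set R) -> 0 < v /\ v <= 1.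
Proof. by rewrite inE/= in_itv/= => /andP[]. Qed.

Let pow01 v : 0 < v -> v <= 1 -> 0 < v `^ al^-1 <= 1.
Proof.
move=> v0 v1; rewrite powR_gt0//= -[leRHS](congr1 (@^~ al^-1) (@powR1 R)).
by rewrite ge0_ler_powR ?nnegrE// ?ltW.
Qed.

Section truncated_transform.
Variables T x : R.

Let f (p : R * R) := cos (p.1 * x) * (sin (p.2 `^ al^-1 * p.1) / p.1).

Let mf : measurable_fun setT f.
Proof.
apply: measurable_funM.
  by apply: (measurableT_comp measurable_cos); exact: measurable_funM.
apply: measurable_funM; last exact: (measurableT_comp measurable_inv measurable_fst).
apply: (measurableT_comp measurable_sin); apply: measurable_funM => //.
exact: (measurableT_comp (@measurable_powR R al^-1)).
Qed.

Let fst_le1 t v : 0 < v -> v <= 1 -> `|sin (v `^ al^-1 * t) / t| <= 1.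
Proof.
move=> v0 v1; have /andP[u0 u1] := pow01 v0 v1.
by rewrite (le_trans (normr_sinV_le _ _))// gtr0_norm.
Qed.

Let f_le1 t v : 0 < v -> v <= 1 -> `|f (t, v)| <= 1.
Proof. by move=> v0 v1; rewrite /f/= normrM mulr_ile1 ?cos_max ?fst_le1. Qed.

Lemma measurable_dirichlet_kernel_powR :
  measurable_fun (`]0%R, 1%R] : set R) (fun v : R => dirichlet_kernel T (v `^ al^-1) x).
Proof.
have h : leb.-integrable `]0, 1]
    (EFin \o (fun v => \int[leb]_(t in `]0, T]) f (t, v))).
  apply: (@bounded_integrable_Rintegral _ _ _ _ _ leb leb `]0%R, 1%R]%classic
    `]0%R, T]%classic _ _ _ _ (fun p => f (p.2, p.1)) 1) => //.
  - exact: lebesgue_itv_lty.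
  - exact: lebesgue_itv_lty.
  - apply: measurable_funTS; apply: (measurableT_comp mf).
    by apply/measurable_fun_pairP; split; [exact: measurable_snd|exact: measurable_fst].
  - by move=> v t /=; rewrite in_itv/= => /andP[v0 v1] _; exact: f_le1.
by have /measurable_int/measurable_EFinP := h.
Qed.

(** The inversion kernel reappears with [a = v^(1/al)]. As [a <= 1], the integrand is bounded by [1]
    on a bounded rectangle, which justifies the swap. *)
Lemma truncated_kendall_pdf_transform :
  \int[leb]_(t in `]0, T]) (cos (t * x) * pdf t) =
  pi^-1 * \int[leb]_(v in `]0, 1]) dirichlet_kernel T (v `^ al^-1) x.
Proof.
have mpow t : measurable_fun setT (fun v : R => sin (v `^ al^-1 * t)).
  apply: (measurableT_comp measurable_sin).
  by apply: measurable_funM => //; exact: measurable_powR.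
have if1 t : leb.-integrable `]0, 1] (EFin \o (fun v => sin (v `^ al^-1 * t) / t)).
  apply: (@bounded_integrable _ _ _ leb _ _ _ 1) => //.
  - exact: lebesgue_itv_lty.
  - by apply: measurable_funTS; apply: measurable_funM => //; exact: mpow.
  - by move=> v /=; rewrite in_itv/= => /andP[v0 v1]; exact: fst_le1.
transitivity (\int[leb]_(t in `]0, T])
    (pi^-1 * \int[leb]_(v in `]0, 1]) f (t, v))).
  apply: eq_Rintegral => t; rewrite inE/= in_itv/= => /andP[t0 _].
  by rewrite kendall_pdfE// mulrCA -RintegralZl.
rewrite (@RintegralZl _ _ _ leb _ (fun t => \int[leb]_(v in `]0, 1]) f (t, v)) pi^-1); last 2 first.
- exact: measurable_itv.
- apply: (@bounded_integrable_Rintegral _ _ _ _ _ leb leb `]0%R, T]%classic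
    `]0%R, 1%R]%classic _ _ _ _ f 1) => //.
  + exact: lebesgue_itv_lty.
  + exact: lebesgue_itv_lty.
  + exact: measurable_funTS.
  + by move=> t v _ /=; rewrite in_itv/= => /andP[]; exact: f_le1.
rewrite (@bounded_Rintegral_swap _ _ _ _ _ leb leb `]0%R, T]%classic `]0%R, 1%R]%classic
  _ _ _ _ f 1)//.
- exact: lebesgue_itv_lty.
- exact: lebesgue_itv_lty.
- exact: measurable_funTS.
- by move=> t v _ /=; rewrite in_itv/= => /andP[]; exact: f_le1.
Qed.

End truncated_transform.

(** Taking powers preserves the order, so this is the sign of [v - x^al]. Its average over [v] then
    only involves lengths of intervals. *)
Let sg_powR v x : 0 < v -> 0 <= x -> Num.sg (v `^ al^-1 - x) =
  \1_(`]x `^ al, +oo[%classic : set R) v - \1_(`]-oo, x `^ al[%classic : set R) v.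
Proof.
move=> v0 x0; rewrite !indicE !mem_setE !in_itv/= andbT.
have xE : (x `^ al) `^ al^-1 = x by rewrite -powRrM mulfV// powRr1.
have c0 : 0 <= x `^ al := powR_ge0 _ _.
case: ltgtP => vx; rewrite ?subr0 ?sub0r ?subrr.
- by rewrite gtr0_sg// subr_gt0 -[X in X < _]xE gt0_ltr_powR// nnegrE ltW.
- by rewrite ltr0_sg// subr_lt0 -[X in _ < X]xE gt0_ltr_powR// nnegrE ltW.
- by rewrite -vx xE subrr sgr0.
Qed.

Let lebesgue_above c : 0 <= c ->
  fine (leb (`]c, +oo[%classic `&` `]0, 1]%classic)) = Num.max 0 (1 - c).
Proof.
move=> c0.
have -> : `]c, +oo[%classic `&` `]0, 1]%classic = `]c, 1]%classic :> set R.
  apply/seteqP; split => v /=; rewrite !in_itv/= ?andbT; first by case=> -> /andP[].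
  by move=> /andP[cv ->]; rewrite cv (le_lt_trans c0 cv).
rewrite lebesgue_measure_itv/= lte_fin; case: ltP => /= c1.
  by rewrite max_r// subr_ge0 ltW.
by rewrite max_l// subr_le0.
Qed.

Let lebesgue_below c : 0 <= c ->
  fine (leb (`]-oo, c[%classic `&` `]0, 1]%classic)) = 1 - Num.max 0 (1 - c).
Proof.
move=> c0; have [c1|c1] := leP c 1.
  have -> : `]-oo, c[%classic `&` `]0, 1]%classic = `]0, c[%classic :> set R.
    apply/seteqP; split => v /=; rewrite !in_itv/=; first by case=> -> /andP[->].
    by move=> /andP[-> vc]; rewrite vc (le_trans (ltW vc) c1).
  rewrite max_r ?subr_ge0// opprB addrC subrK lebesgue_measure_itv/= lte_fin.
  case: ltP => /= c0'; first by rewrite oppr0 addr0.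
  by apply/eqP; rewrite eq_le c0 c0'.
have -> : `]-oo, c[%classic `&` `]0, 1]%classic = `]0, 1]%classic :> set R.
  apply/seteqP; split => v /=; rewrite !in_itv/=; first by case=> _ /andP[-> ->].
  by move=> /andP[-> v1]; rewrite v1 (le_lt_trans v1 c1).
rewrite max_l ?subr_le0 ?(ltW c1)// subr0.
by rewrite fine_lebesgue_0T.
Qed.

(** With [M = cf x], the set of [v] above [x^al] has length [M] and the set below it [1 - M]. The
    limit is thus [(1/4) (1 + M - (1 - M)) = M / 2], the share of the positive half-line. *)
Lemma cvg_truncated_kendall_pdf_transform x : 0 <= x ->
  \int[leb]_(t in `]0, n%:R]) (cos (t * x) * pdf t) @[n --> \oo] --> 2^-1 * cf x.
Proof.
move=> x0; under eq_fun do rewrite truncated_kendall_pdf_transform.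
have i1 (A : set R) : measurable A -> leb.-integrable `]0, 1] (EFin \o \1_A).
  move=> mA; apply: (@bounded_integrable _ _ _ leb _ _ _ 1 \1_A) => //.
  - exact: lebesgue_itv_lty.
  - by move=> v _; rewrite indicE; case: (_ \in _); rewrite ?normr1 ?normr0.
have -> : 2^-1 * cf x = pi^-1 * \int[leb]_(v in `]0, 1])
    (pi / 4 * (Num.sg (v `^ al^-1 + x) + Num.sg (v `^ al^-1 - x))).
  rewrite (_ : \int[_]_(_ in _) _ = \int[leb]_(v in `]0, 1])
    (pi / 4 * (1 + (\1_(`]x `^ al, +oo[%classic : set R) v -
                    \1_(`]-oo, x `^ al[%classic : set R) v)))); last first.
    apply: eq_Rintegral => v /in01[v0 v1]; rewrite sg_powR// gtr0_sg//.
    by rewrite ltr_wpDr// powR_gt0.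
  have iB : leb.-integrable `]0, 1] (EFin \o (fun v =>
      \1_(`]x `^ al, +oo[%classic : set R) v - \1_(`]-oo, x `^ al[%classic : set R) v)).
    by apply: (integrableB _ (i1 _ _) (i1 _ _)).
  have ic : leb.-integrable `]0, 1] (EFin \o (fun=> 1 : R)).
    apply: (@bounded_integrable _ _ _ leb _ _ _ 1 (fun=> 1)) => //.
    - exact: lebesgue_itv_lty.
    - by move=> v _; rewrite normr1.
  rewrite RintegralZl//; last exact: (integrableD _ ic iB).
  rewrite RintegralD// RintegralB; [|by []|exact: i1|exact: i1].
  rewrite Rintegral_cst// fine_lebesgue_0T// mul1r.
  rewrite /Rintegral !integral_indic// lebesgue_above ?powR_ge0//.
  rewrite lebesgue_below ?powR_ge0// /kendall_cf (ger0_norm x0).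
  have pi0 : pi != 0 :> R by rewrite gt_eqF ?pi_gt0.
  by move: (Num.max _ _) (@pi R) pi0 => M p p0; field.
apply: cvgM; first exact: cvg_cst.
apply: (@bounded_Rintegral_cvg _ _ _ leb _ _ _ (pi / 2 + 2)) => //.
- exact: lebesgue_itv_lty.
- by move=> n; exact: measurable_dirichlet_kernel_powR.
- by move=> n v _; exact: normr_dirichlet_kernel_le.
- by move=> v _; exact: cvg_dirichlet_kernel.
Qed.

End kendall_transform.

Section density_Rintegral.
Context {R : realType}.
Notation leb := (@lebesgue_measure R).
Variables (m : probability (measurableTypeR R) R) (g : R -> R).
Hypothesis mg : has_density m g.

Let mg1 : measurable_fun setT g. Proof. by have [] := mg. Qed.
Let g0 t : 0 <= g t. Proof. by have [_ /(_ t)] := mg. Qed.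
Let mE A : measurable A -> m A = (\int[leb]_(t in A) (g t)%:E)%E.
Proof. by have [_ _ /(_ A)] := mg. Qed.

Let gi : leb.-integrable setT (EFin \o g).
Proof.
apply/integrableP; split; first exact/measurable_EFinP.
under eq_integral do rewrite gee0_abs ?lee_fin ?g0//.
by rewrite -mE// (@probability_lty _ _ _ m).
Qed.

Let g1 : \int[leb]_t g t = 1.
Proof. by rewrite /Rintegral -mE// (congr1 fine (probability_setT m)). Qed.

Lemma Rintegral_density (f : R -> R) (C : R) : measurable_fun setT f ->
  (forall x, `|f x| <= C) -> \int[m]_x f x = \int[leb]_t (g t * f t).
Proof.
move=> mf fC.
have gf : leb.-integrable setT (EFin \o (fun t => g t * f t)).
  apply: (@le_integrable _ _ _ leb setT _ _ (fun t => C%:E * (g t)%:E)%E) => //.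
  - by apply/measurable_EFinP; exact: measurable_funM.
  - move=> t _; rewrite /= lee_fin !normrM mulrC ler_wpM2r//.
    by rewrite (le_trans (fC t))// ler_norm.
  - exact: integrableZl.
have gC : leb.-integrable setT (EFin \o (fun t => g t * C)).
  by apply: eq_integrable (integrableZl measurableT C gi) => // t _; rewrite /= mulrC.
have fi : m.-integrable setT (EFin \o f) by exact: law_integrable fC.
have C0 : 0 <= C by rewrite (le_trans _ (fC 0)).
have Ci : m.-integrable setT (EFin \o (fun=> C)).
  by apply: (@law_integrable _ m (fun=> C) C) => // x; rewrite ger0_norm.
(* Adding [C] makes the integrand nonnegative; its contribution cancels because [g] has integral
   [1]. *)
suff : \int[m]_x (f x + C) = \int[leb]_t (g t * f t + g t * C).
  rewrite RintegralD// RintegralD// law_Rintegral_cst RintegralZr// g1 mul1r.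
  exact: addIr.
congr fine; rewrite (@ge0_integral_density _ (measurableTypeR R) R m leb g mg1 g0 mE)//.
- by apply: eq_integral => t _; rewrite -EFinM mulrDr.
- by apply/measurable_EFinP; exact: measurable_funD.
- by move=> x; rewrite lee_fin -lerBlDr sub0r; have /ler_normlP[] := fC x; lra.
Qed.

Lemma Rintegral_density_indic (f : R -> R) (C : R) (D : set R) : measurable D ->
  measurable_fun setT f -> (forall x, `|f x| <= C) ->
  \int[m]_x (f x * \1_D x) = \int[leb]_(t in D) (f t * g t).
Proof.
move=> mD mf fC; rewrite (@Rintegral_density _ C).
- rewrite [RHS]Rintegral_mkcond; apply: eq_Rintegral => t _.
  by rewrite patchE indicE; case: ifPn; rewrite ?mulr1 ?mulr0// mulrC.
- by apply: measurable_funM => //; exact: measurable_indic.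
- move=> x; rewrite normrM indicE; case: (_ \in _).
    by rewrite normr1 mulr1.
  by rewrite normr0 mulr0 (le_trans _ (fC 0)).
Qed.

End density_Rintegral.

Definition kendall_measure {R : realType} (al : R) (A : set (measurableTypeR R)) : \bar R :=
  (\int[lebesgue_measure]_(t in A) (kendall_pdf al t)%:E)%E.

(** * Total mass, symmetry and transform of the law *)

Section kendall_law.
Context {R : realType}.
Notation leb := (@lebesgue_measure R).
Variable al : R.
Hypotheses (al_gt0 : 0 < al) (al_le1 : al <= 1).
Local Notation pdf := (kendall_pdf al).
Local Notation cf := (kendall_cf al).

Let pdf_ge0 t : 0 <= pdf t. Proof. exact: kendall_pdf_ge0. Qed.
Let mpdf : measurable_fun setT pdf. Proof. exact: measurable_kendall_pdf. Qed.

Local Notation mu := (kendall_measure al).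

Let mu0 : mu set0 = 0%E.
Proof. exact: integral_set0. Qed.

Let mu_ge0 A : (0 <= mu A)%E.
Proof. by apply: integral_ge0 => x _; rewrite lee_fin. Qed.

Let mu_sigma_additive : semi_sigma_additive mu.
Proof.
move=> /= F mF tF mUF; apply: cvg_toP.
  apply: ereal_nondecreasing_is_cvgn => m n mn.
  by apply: lee_sum_nneg_natr => // k _ _; exact: mu_ge0.
rewrite /kendall_measure ge0_integral_bigcup//=.
- by apply/measurable_funTS/measurableT_comp.
- by move=> x _; rewrite lee_fin.
Qed.

HB.instance Definition _ := isMeasure.Build _ _ _
  mu mu0 mu_ge0 mu_sigma_additive.

Lemma kendall_cf0 : cf 0 = 1.
Proof. by rewrite /kendall_cf normr0 powR0 ?gt_eqF// subr0 max_r. Qed.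

Let mu_opp (A : set R) : measurable A -> mu (-%R @^-1` A) = mu A.
Proof.
move=> mA; rewrite /kendall_measure.
rewrite (_ : -%R @^-1` A = (-%R : _ -> measurableTypeR R) @^-1` A)//.
transitivity (\int[leb]_(t in (-%R : _ -> measurableTypeR R) @^-1` A) (pdf (- t))%:E)%E.
  by apply: eq_integral => t _; rewrite kendall_pdfN.
have mopp : measurable_fun setT (-%R : measurableTypeR R -> measurableTypeR R).
  exact: oppr_measurable.
rewrite -(@ge0_integral_pushforward _ _ (measurableTypeR R) (measurableTypeR R) R _ mopp leb A
  (fun t => (pdf t)%:E))//=.
- by apply: eq_measure_integral => //= B mB _; exact: lebesgue_measureN.
- by apply/measurable_EFinP/measurable_funTS.
- by move=> y _; rewrite lee_fin.
Qed.

(** Makes the mass of bounded intervals finite while the total mass is still unknown. *)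
Let pdf_le t : 0 < t -> pdf t <= pi^-1.
Proof.
move=> t0; rewrite kendall_pdfE// ler_piMr ?invr_ge0 ?pi_ge0//.
have := @le_norm_Rintegral _ _ _ leb `]0%R, 1%R]%classic (measurable_itv _)
  (lebesgue_itv_lty _ _ _ _) 1 (fun v => sin (v `^ al^-1 * t) / t).
rewrite fine_lebesgue_0T// mulr1 => h; rewrite (le_trans (ler_norm _))// h//.
- apply: measurable_funTS; apply: measurable_funM => //.
  apply: (measurableT_comp measurable_sin).
  by apply: measurable_funM => //; exact: measurable_powR.
- move=> v /=; rewrite in_itv/= => /andP[v0 v1].
  rewrite (le_trans (normr_sinV_le _ _))// ger0_norm ?powR_ge0//.
  rewrite -[leRHS](congr1 (@^~ al^-1) (@powR1 R)).
  by rewrite ge0_ler_powR ?nnegrE// ?invr_ge0 ltW.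
Qed.

(** At [x = 0] the truncated transform is the mass of []0, n]], so its limit [cf 0 / 2] is the mass
    of the half-line. *)
Let mu_half : mu `]0, +oo[%classic = (2^-1)%:E.
Proof.
pose F n : set (measurableTypeR R) := [set` `]0%R, n%:R%R]].
have -> : `]0, +oo[%classic = \bigcup_n F n.
  apply/seteqP; split => [t|t [n _]]; rewrite /F /= !in_itv/= ?andbT; last by move=> /andP[].
  move=> t0; exists (Num.truncn t).+1 => //=; rewrite in_itv/= t0/=.
  by rewrite ltW// truncnS_gt.
have h : mu (F n) @[n --> \oo] --> mu (\bigcup_n F n).
  apply: nondecreasing_cvg_mu.
  - by move=> n; exact: measurable_itv.
  - by apply: bigcupT_measurable => n; exact: measurable_itv.
  - move=> a b ab; apply/subsetPset => t; rewrite /F /= !in_itv/= => /andP[-> ta].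
    by rewrite (le_trans ta)// ler_nat.
have h2 := cvg_truncated_kendall_pdf_transform al_gt0 al_le1 (lexx 0).
have muF n : mu (F n) = (\int[leb]_(t in `]0, n%:R]) (cos (t * 0) * pdf t))%:E.
  rewrite -[LHS]fineK; last first.
    apply: integrable_fin_num; first exact: measurable_itv.
    apply: (@bounded_integrable _ _ _ leb _ _ _ pi^-1 pdf) => //.
    - exact: measurable_itv.
    - exact: lebesgue_itv_lty.
    - exact: measurable_funTS.
    - by move=> t; rewrite /F/= in_itv/= => /andP[t0 _]; rewrite ger0_norm// pdf_le.
  by congr EFin; apply: eq_Rintegral => t _; rewrite mulr0 cos0 mul1r.
rewrite -(cvg_lim _ h)//; apply/cvg_lim => //.
rewrite kendall_cf0 mulr1 in h2.
under eq_fun do rewrite muF.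
by apply: cvg_EFin; [exact: nearW|exact: h2].
Qed.

Let mu_setT : mu setT = 1%E.
Proof.
have -> : [set: measurableTypeR R] = `]-oo, 0[%classic `|` ([set 0] `|` `]0, +oo[%classic).
  apply/seteqP; split => // t _ /=; rewrite !in_itv/= andbT.
  by case: (ltgtP t 0) => [|_|->]; [left|right;right|right;left].
have UE (A B : set (measurableTypeR R)) : measurable A -> measurable B ->
    A `&` B = set0 -> mu (A `|` B) = (mu A + mu B)%E.
  by move=> mA mB AB; rewrite measureU.
rewrite UE//; last 2 first.
  exact: measurableU.
  apply/seteqP; split => // t []/=; rewrite !in_itv/= andbT => t0 [t1|].
    by rewrite t1 ltxx in t0.
  by rewrite ltNge (ltW t0).
rewrite UE//; last first.
  by apply/seteqP; split => // t []/= ->; rewrite in_itv/= ltxx.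
have -> : mu [set 0] = 0%E by rewrite /kendall_measure integral_set1.
have -> : mu `]-oo, 0[%classic = mu `]0, +oo[%classic.
  rewrite -(mu_opp (measurable_itv `]0%R, +oo[)); congr (mu _).
  by apply/seteqP; split => t /=; rewrite !in_itv/= andbT oppr_gt0.
by rewrite mu_half add0e -EFinD; congr EFin; lra.
Qed.

HB.instance Definition _ :=
  @Measure_isProbability.Build _ _ R mu mu_setT.

Definition kendall_law : probability (measurableTypeR R) R := mu.

Lemma has_density_kendall_law : has_density kendall_law pdf.
Proof. by split. Qed.

Lemma symmetric_kendall_law : symmetric_law kendall_law.
Proof.
move=> A mA; transitivity (mu (-%R @^-1` A)); last exact: mu_opp.
rewrite /dilation /distribution /pushforward/=; congr (mu _).
by apply/seteqP; split => t; rewrite /= /scale_fun mulN1r.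
Qed.

(** Since the law is now known to be a probability, dominated convergence identifies the limit of
    the truncated transforms with the integral over the positive half-line. Symmetry doubles it. *)
Lemma cos_transform_kendall_law x : cos_transform kendall_law x = cf x.
Proof.
rewrite -cos_transform_abs (_ : cf x = cf `|x|); last by rewrite /kendall_cf normr_id.
have := normr_ge0 x; move: `|x| => {}x x0.
pose D : set R := `]0, +oo[%classic.
pose E : set R := `]-oo, 0[%classic.
have cos1 t : `|cos (x * t)| <= 1 by exact: cos_max.
have cosD (A : set R) t : `|cos (x * t) * \1_A t| <= 1.
  rewrite normrM mulr_ile1// indicE.
  by case: (_ \in _); rewrite ?normr1 ?normr0.
have mcosD (A : set R) : measurable A -> measurable_fun setT (fun t => cos (x * t) * \1_A t).
  by move=> mA; apply: measurable_funM; [exact: measurable_cosM|exact: measurable_indic].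
have icosD (A : set R) : measurable A ->
    kendall_law.-integrable setT (EFin \o (fun t => cos (x * t) * \1_A t)).
  by move=> mA; apply: (@law_integrable _ kendall_law _ 1) => //; exact: mcosD.
have mD : measurable D by exact: measurable_itv.
have mE : measurable E by exact: measurable_itv.
have m1 : measurable ([set 0] : set R) by exact: measurable_set1.
have ID : \int[kendall_law]_t (cos (x * t) * \1_D t) = 2^-1 * cf x.
  have h := cvg_truncated_kendall_pdf_transform al_gt0 al_le1 x0.
  pose F n : set R := [set` `]0%R, n%:R%R]].
  have h2 : \int[kendall_law]_t (cos (x * t) * \1_(F n) t) @[n --> \oo] -->
      \int[kendall_law]_t (cos (x * t) * \1_D t).
    apply: (@law_Rintegral_cvg _ kendall_law _ _ 1) => //.
    - by move=> n; apply: mcosD; exact: measurable_itv.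
    - move=> t; apply: cvgM; first exact: cvg_cst.
      rewrite indicE /D mem_setE in_itv/= andbT; case: ltP => t0; last first.
        apply: cvg_near_cst; apply: nearW => n.
        by rewrite indicE /F mem_setE in_itv/= ltNge t0.
      apply: cvg_near_cst; near=> n.
      rewrite indicE /F mem_setE in_itv/= t0/=.
      suff -> : t <= n%:R by [].
      by near: n; exact: nbhs_infty_ger.
  apply: (cvg_unique (@Rhausdorff R) h2); apply: cvg_trans h.
  apply: near_eq_cvg; apply: nearW => n; rewrite (Rintegral_density_indic has_density_kendall_law (C := 1))//.
  - by apply: eq_Rintegral => t _; rewrite (mulrC t).
  - exact: measurable_itv.
  - exact: measurable_cosM.
have IE : \int[kendall_law]_t (cos (x * t) * \1_E t) = 2^-1 * cf x.
  rewrite -ID -(Rintegral_symmetric symmetric_kendall_law (mcosD _ mE) (cosD _)).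
  apply: eq_Rintegral => t _; rewrite mulrN cosN; congr (_ * _).
  by rewrite !indicE /D /E !mem_setE !in_itv/= oppr_lt0 andbT.
have I0 : \int[kendall_law]_t (cos (x * t) * \1_[set 0] t) = 0.
  rewrite (Rintegral_density_indic has_density_kendall_law (C := 1))//; last first.
    exact: measurable_cosM.
  by rewrite Rintegral_set1.
transitivity (\int[kendall_law]_t ((cos (x * t) * \1_D t + cos (x * t) * \1_E t) +
                cos (x * t) * \1_[set 0] t)).
  apply: eq_Rintegral => t _; rewrite -!mulrDr !indicE /D /E !mem_setE !in_itv/= andbT.
  have -> : (t \in [set (0 : R)]) = (t == 0) by apply/idP/eqP; rewrite inE.
  by case: (ltgtP t 0) => [||->]; rewrite ?eqxx ?addr0 ?add0r ?mulr1.
rewrite RintegralD//; [|exact: (integrableD _ (icosD _ _) (icosD _ _))|exact: icosD].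
rewrite RintegralD//; [|exact: icosD|exact: icosD].
by rewrite ID IE I0; lra.
Unshelve. all: by end_near. Qed.

End kendall_law.

(** * Kendall convolution *)

Section pareto_integral.
Context {R : realType}.
Notation leb := (@lebesgue_measure R).
Variable alpha : {posnum R}.
Local Notation al := (alpha%:num).
Implicit Types (h : R -> R).

Let al_gt0 : 0 < al. Proof. by []. Qed.

Lemma measurable_kendall_cf : measurable_fun setT (@kendall_cf R al).
Proof.
apply: measurable_maxr => //; apply: measurable_funB => //.
by apply: (measurableT_comp (@measurable_powR R al)); exact: normr_measurable.
Qed.

Lemma kendall_cf_ge0 (x : R) : 0 <= kendall_cf al x.
Proof. by rewrite /kendall_cf le_max lexx. Qed.

Lemma kendall_cf_le1 (x : R) : `|kendall_cf al x| <= 1.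
Proof.
by rewrite ger0_norm ?kendall_cf_ge0// /kendall_cf ge_max ler01 gerBl powR_ge0.
Qed.

Lemma kendall_cfM (t x : R) : 0 <= t -> 0 <= x ->
  kendall_cf al (t * x) = Num.max 0 (1 - t `^ al * x `^ al).
Proof. by move=> t0 x0; rewrite /kendall_cf ger0_norm ?mulr_ge0// powRM. Qed.

(* For [0 < A < 1] the integrand vanishes beyond [c := A `^ (- al^-1)], and on [1, c]
   it has the antiderivative [- s `^ (- 2 al) + 2 A s `^ (- al)]. *)
Lemma integral_pareto_kendall_cf (A : R) : 0 <= A ->
  (\int[pareto_prob (twice alpha)]_s (Num.max 0 (1 - A * `|s| `^ al))%:E =
   ((Num.max 0 (1 - A)) ^+ 2)%:E)%E.
Proof.
move=> A0; set p := twice alpha.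
have mh : measurable_fun setT (fun s : R => Num.max 0 (1 - A * `|s| `^ al)).
  apply: measurable_maxr => //; apply: measurable_funB => //.
  apply: measurable_funM => //.
  by apply: (measurableT_comp (@measurable_powR R al)); exact: normr_measurable.
rewrite (@ge0_integral_density _ (measurableTypeR R) R (pareto_prob p) leb
  (pareto_pdf p%:num))//; last 4 first.
- exact: measurable_pareto_pdf.
- by move=> t; exact: pareto_pdf_ge0.
- exact/measurable_EFinP.
- by move=> y; rewrite lee_fin le_max lexx.
have pdfE (s : R) : 1 <= s -> pareto_pdf p%:num s = 2 * al * s `^ (- (2 * al) - 1).
  by move=> s1; rewrite /pareto_pdf patchE mem_set//= in_itv/= s1.
have [A1|A1] := leP 1 A.
  rewrite max_l ?subr_le0// expr0n/= integral0_eq// => s _.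
  have [s1|s1] := leP 1 s; last first.
    by rewrite /pareto_pdf patchE memNset ?mul0e//= in_itv/= andbT; apply/negP; rewrite -ltNge.
  rewrite ger0_norm ?(le_trans ler01)// max_l ?mule0// subr_le0 (le_trans A1)// ler_peMr ?(le_trans ler01)//.
  rewrite -[leLHS](congr1 (@^~ al) (@powR1 R)).
  by rewrite ge0_ler_powR ?nnegrE// (le_trans ler01).
(* The case [A = 0] is apart: the cut-off is at infinity, whereas the power of [0] defining [c]
   would be [0] by convention. *)
move: A0; rewrite le_eqVlt => /predU1P[A0|A0].
  rewrite -A0 subr0 max_r// expr1n -(integral_pareto_pdf (b := p%:num))//.
  by apply: eq_integral => s _; rewrite mul0r subr0 max_r// mule1.
pose c := A `^ (- al^-1).
have cal : c `^ (- al) = A.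
  by rewrite /c -powRrM mulrNN mulVf// powRr1// ltW.
have c0 : 0 < c by rewrite powR_gt0.
have cE (s : R) : 0 < s -> (1 - A * s `^ al <= 0) = (c <= s).
  move=> s0; rewrite subr_le0 -cal powRN ler_pdivlMl ?powR_gt0// mulr1.
  apply/idP/idP => cs; last by rewrite ge0_ler_powR ?nnegrE// ltW.
  rewrite leNgt; apply/negP => sc; move: cs; rewrite leNgt => /negP; apply.
  by rewrite gt0_ltr_powR ?nnegrE// ltW.
have c1 : 1 <= c.
  by rewrite leNgt; apply/negP => /ltW; rewrite -cE// powR1 mulr1 subr_le0 leNgt A1.
pose f (s : R) := 2 * al * s `^ (- (2 * al) - 1) * (1 - A * s `^ al).
pose F (s : R) := - s `^ (- (2 * al)) + 2 * A * s `^ (- al).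
transitivity (\int[leb]_(s in `[1%R, c]) (f s)%:E)%E.
  rewrite [RHS]integral_mkcond; apply: eq_integral => s _; rewrite patchE.
  have [s1|s1] := ltP s 1.
    rewrite memNset ?/pareto_pdf ?patchE ?memNset ?mul0e//= in_itv/= ?andbT;
      by apply/negP; rewrite ?negb_and -!ltNge ?s1.
  have s0 : 0 < s by exact: lt_le_trans s1.
  rewrite pdfE// gtr0_norm//; have [sc|sc] := leP s c.
    rewrite mem_set/= ?in_itv/= ?s1// -EFinM /f; congr (_ * _)%:E.
    have [->|sc'] := eqVneq s c.
      rewrite max_l ?cE//; apply/eqP; rewrite eq_le; apply/andP; split.
        rewrite subr_ge0 -[X in X * _]cal powRN mulVf//.
        by rewrite gt_eqF// powR_gt0.
      by rewrite cE.
    by rewrite max_r// ltW// ltNge cE// -ltNge lt_neqAle sc' sc.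
  rewrite memNset/= ?in_itv/= ?s1/=; last by apply/negP; rewrite -ltNge.
  by rewrite max_l ?mule0// cE// ltW.
(* Since [c^(- al) = A], the difference is [(- A^2 + 2 A^2) - (- 1 + 2 A) = (1 - A)^2]. *)
transitivity (F c - F 1)%:E; first apply: (@integral_FTC2 _ f F) => //; last first.
- congr EFin; rewrite /F !powR1 mulr1 cal max_r; last by rewrite subr_ge0 ltW.
  have -> : c `^ (- (2 * al)) = A ^+ 2.
    by rewrite mulrC -mulNr powRrM cal powR_mulrn// ltW.
  by ring.
- move=> s /andP[s1 _]; have s0 : 0 < s by exact: lt_le_trans s1.
  apply: cvgM.
    by apply: cvgM; [exact: cvg_cst|exact: continuous_powR_gt0].
  apply: cvgB; first exact: cvg_cst.
  by apply: cvgM; [exact: cvg_cst|exact: continuous_powR_gt0].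
- move=> s /andP[s1 _]; have s0 : 0 < s by exact: lt_le_trans s1.
  have d1 := @is_derive1_powR R (- (2 * al)) s s0.
  have d2 := @is_derive1_powR R (- al) s s0.
  apply: is_derive_eq; rewrite /GRing.scale/= /f.
  have -> : s `^ (- al - 1) = s `^ (- (2 * al) - 1) * s `^ al.
    rewrite -powRD; last by rewrite (gt_eqF s0) implybT.
    by congr (_ `^ _); move: (alpha%:num) => q; ring.
  by ring.
Qed.

End pareto_integral.

Section kendall_integral.
Context {R : realType}.
Variable alpha : {posnum R}.
Local Notation al := (alpha%:num).
Notation law := (probability (measurableTypeR R) R).
Local Notation kd := (kendall_dirac alpha).
Let D : set (measurableTypeR R) := `[0, +oo[%classic.
Let mD : measurable D. Proof. exact: measurable_itv. Qed.

Section ge0.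
Variable h : R -> \bar R.
Hypotheses (mh : measurable_fun setT h) (h0 : forall x, (0 <= h x)%E).
Local Open Scope ereal_scope.

Lemma ge0_integral_kendall_dirac (a b : R) :
  let M := Num.max a b in let x := (Num.min a b / M)%R in
  (0 <= a)%R -> (0 <= b)%R -> (0 < M)%R ->
  \int[kd a b]_s h s = (1 - x `^ al)%:E * h M +
    (x `^ al)%:E * \int[pareto_prob (twice alpha)]_s h (M * s)%R.
Proof.
move=> M x a0 b0 M0.
have x0 : (0 <= x)%R by rewrite divr_ge0// ?le_min ?a0 ?b0// ltW.
have x1 : (x <= 1)%R by rewrite ler_pdivrMr// mul1r ge_min le_max lexx.
have p0 : (0 <= 1 - x `^ al)%R.
  rewrite subr_ge0 -[leRHS](congr1 (@^~ al) (@powR1 R)).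
  by apply: ge0_ler_powR; rewrite ?nnegrE.
pose q := NngNum (powR_ge0 x al).
pose P : law := dilation M (pareto_prob (twice alpha)).
pose nu := measure_add (mscale (NngNum p0) (\d_(M : measurableTypeR R)))
                       (mscale q P).
have [m [mE _]] := kendall_diracP alpha a b.
rewrite mE (@eq_measure_integral _ _ _ setT nu); last first.
  move=> A mA _; rewrite -mE /kendall_dirac M0.
  transitivity ((1 - x `^ al)%:E * \d_M A + (x `^ al)%:E * P A)%E; last first.
    by rewrite /nu /= /measure_add /msum/= !big_ord_recl big_ord0 adde0.
  rewrite /kendall_unit /pushforward/= !diracE.
  by congr (_ * (_ : bool)%:R%:E + _); apply/asbool_equiv_eq; rewrite /= /scale_fun mulr1.
rewrite ge0_integral_measure_add// !ge0_integral_mscale// integral_dirac// diracT mul1e.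
by rewrite ge0_integral_distribution.
Qed.

Lemma integral_kendall_dirac00 : \int[kd 0 0]_s h s = h 0.
Proof.
by rewrite /kendall_dirac maxxx ltxx integral_dirac// diracT mul1e.
Qed.

(** [kendall_dirac] is a bare set function; choosing the measure behind it allows the mixture lemmas
    to apply. *)
Let k (p : measurableTypeR R * measurableTypeR R) :
  {measure set (measurableTypeR R) -> \bar R} :=
  projT1 (cid (kendall_diracP alpha p.1 p.2)).

Let kE p : kd p.1 p.2 = k p.
Proof. by rewrite /k; case: cid => m []. Qed.

Let i2 (p : measurableTypeR R * measurableTypeR R) : R := (\1_D p.1 * \1_D p.2)%R.

Let i2_ge0 p : (0 <= i2 p)%R. Proof. by rewrite /i2 !indicE mulr_ge0. Qed.

Let mi2 : measurable_fun setT i2.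
Proof.
apply: measurable_funM.
  exact: (measurableT_comp (@measurable_indic _ _ R setT D mD) measurable_fst).
exact: (measurableT_comp (@measurable_indic _ _ R setT D mD) measurable_snd).
Qed.

(** The weight [i2] encodes the restriction of both integrals to [[0, +oo[]. *)
Let k2 p : {measure set (measurableTypeR R) -> \bar R} :=
  mscale (NngNum (i2_ge0 p)) (k p).

Let mk2 A : measurable A -> measurable_fun setT (fun p => k2 p A).
Proof.
move=> mA; apply: emeasurable_funM; first exact/measurable_EFinP.
have := @measurable_kendall_dirac R alpha A mA.
by apply: eq_measurable_fun => p _; rewrite kE.
Qed.

Lemma measurable_integral_kendall_dirac : measurable_fun setT
  (fun p : measurableTypeR R * measurableTypeR R => \int[kd p.1 p.2]_s h s).
Proof.
have mk A : measurable A -> measurable_fun setT (fun p => k p A).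
  move=> mA; have := @measurable_kendall_dirac R alpha A mA.
  by apply: eq_measurable_fun => p _; rewrite kE.
have := measurable_integral_mixture mk mh h0.
by apply: eq_measurable_fun => p _; rewrite kE.
Qed.

Lemma ge0_integral_kendall (l1 l2 : plaw R) :
  \int[kendall alpha l1 l2]_s h s =
  \int[l1]_a \int[l2]_b ((\1_D a * \1_D b)%:E * \int[kd a b]_s h s).
Proof.
have E (l1' l2' : law) A : \int[l1']_(a in D) \int[l2']_(b in D) kd a b A =
    \int[l1']_a \int[l2']_b ((i2 (a, b))%:E * k (a, b) A).
  rewrite integral_mkcond; apply: eq_integral => a _; rewrite patchE /i2/= indicE.
  case: ifPn => aD.
    rewrite integral_mkcond; apply: eq_integral => b _; rewrite patchE indicE mul1r.
    by case: ifPn => bD; rewrite ?mul0e// mul1e -kE.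
  by apply/esym/integral0_eq => b _; rewrite mul0r mul0e.
rewrite (@ge0_integral_mixture _ _ _ _ _ (l1 \x l2) k2)//.
- rewrite fubini_tonelli1; last 2 first.
  + exact: (measurable_integral_mixture mk2 mh h0).
  + by move=> p; exact: integral_ge0.
  apply: eq_integral => a _; apply: eq_integral => b _.
  by rewrite ge0_integral_mscale//= -kE.
- move=> A mA; rewrite [LHS]E fubini_tonelli1//=; last exact: mk2.
Qed.

End ge0.

Lemma plaw_setC (l : plaw R) : l (~` D) = 0%E.
Proof. by rewrite probability_setC// (plaw_ge0 l) subee. Qed.

Lemma eq_plaw_integral (l : plaw R) (f g : R -> \bar R) :
  measurable_fun setT f -> measurable_fun setT g ->
  (forall x, 0 <= x -> f x = g x) -> (\int[l]_x f x = \int[l]_x g x)%E.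
Proof.
move=> mf mg fg; apply: ae_eq_integral => //.
exists (~` D); split; [exact: measurableC|exact: plaw_setC|].
move=> x /= h; apply: contra_not h => Dx _; apply: fg.
by move: Dx; rewrite /D/= in_itv/= andbT.
Qed.

Local Notation cf := (kendall_cf al).

(** With [A = (t M)^al] and [X = x^al], for [A <= 1] this is the identity [(1 - X) (1 - A) + X (1 -
    A)^2 = (1 - A) (1 - A X)]. For [A >= 1] both sides vanish. *)
Lemma integral_kendall_dirac_cf (t a b : R) : 0 <= t -> 0 <= a -> 0 <= b ->
  (\int[kd a b]_s (cf (t * s))%:E = (cf (t * a) * cf (t * b))%:E)%E.
Proof.
move=> t0 a0 b0.
have mcf : measurable_fun setT (fun s : R => (cf (t * s))%:E).
  apply/measurable_EFinP; apply: (measurableT_comp (measurable_kendall_cf alpha)).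
  exact: measurable_funM.
have cf0 s : (0 <= (cf (t * s))%:E)%E by rewrite lee_fin kendall_cf_ge0.
have := le_max b a b; rewrite lexx orbT => /esym bM.
have M0' : 0 <= Num.max a b by rewrite (le_trans b0).
move: (M0'); rewrite le_eqVlt => /predU1P[M0|M0].
  have [aE bE] : a = 0 /\ b = 0.
    have aM : a <= Num.max a b by rewrite le_max lexx.
    by split; apply/eqP; rewrite eq_le ?a0 ?b0 andbT M0.
  by rewrite aE bE integral_kendall_dirac00// mulr0 kendall_cf0// mulr1.
rewrite ge0_integral_kendall_dirac//.
set M := Num.max a b; set x := Num.min a b / M.
have x0 : 0 <= x by rewrite divr_ge0// le_min a0.
have x1 : x <= 1 by rewrite ler_pdivrMr// mul1r ge_min le_max lexx.
pose A := t `^ al * M `^ al.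
have A0 : 0 <= A by rewrite mulr_ge0 ?powR_ge0.
have MM : 0 <= M by rewrite ltW.
have -> : (\int[pareto_prob (twice alpha)]_s (cf (t * (M * s)))%:E =
    ((Num.max 0 (1 - A)) ^+ 2)%:E)%E.
  rewrite -(integral_pareto_kendall_cf alpha)//; apply: eq_integral => s _; congr EFin.
  by rewrite /kendall_cf mulrA normrM ger0_norm ?mulr_ge0// powRM ?mulr_ge0// powRM.
have -> : cf (t * a) * cf (t * b) = cf (t * M) * cf (t * (M * x)).
  have -> : M * x = Num.min a b by rewrite mulrC divfK// gt_eqF.
  by rewrite /M; case: leP => // _; rewrite mulrC.
have X0 := powR_ge0 x al.
have X1 : x `^ al <= 1.
  rewrite -[leRHS](congr1 (@^~ al) (@powR1 R)).
  by apply: ge0_ler_powR; rewrite ?nnegrE.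
rewrite (kendall_cfM _ t0 MM) (kendall_cfM _ t0 (mulr_ge0 MM x0)).
rewrite (powRM al MM x0) -/A mulrA -/A -!EFinM -EFinD; congr EFin.
have [A1|A1] := leP 1 A.
  have -> : Num.max 0 (1 - A) = 0 by rewrite max_l// subr_le0.
  by rewrite expr0n/= !mulr0 mul0r addr0.
have AX : A * x `^ al <= 1 by rewrite mulr_ile1// ltW.
have -> : Num.max 0 (1 - A) = 1 - A by rewrite max_r// subr_ge0 ltW.
by rewrite max_r ?subr_ge0//; move: (x `^ al) => X; ring.
Qed.

Lemma Rintegral_kendall_cf (l1 l2 : plaw R) (t : R) : 0 <= t ->
  \int[kendall alpha l1 l2]_s cf (t * s) =
  (\int[l1]_a cf (t * a)) * (\int[l2]_b cf (t * b)).
Proof.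
move=> t0.
have mcf : measurable_fun setT (fun s : R => cf (t * s)).
  apply: (measurableT_comp (measurable_kendall_cf alpha)).
  exact: measurable_funM.
have cf1 s : `|cf (t * s)| <= 1 by exact: kendall_cf_le1.
have mcfE : measurable_fun setT (fun s : R => (cf (t * s))%:E) by exact/measurable_EFinP.
have cf0 s : (0 <= (cf (t * s))%:E)%E by rewrite lee_fin kendall_cf_ge0.
have mD1 : measurable_fun setT (fun b : R => (cf (t * b) * \1_D b)%:E).
  by apply/measurable_EFinP; apply: measurable_funM => //; exact: measurable_indic.
have plawE (l : plaw R) :
    (\int[l]_b (cf (t * b) * \1_D b)%:E = (\int[l]_b cf (t * b))%:E)%E.
  rewrite fineK; last first.
    by apply: integrable_fin_num => //; exact: (@law_integrable _ l _ 1 mcf).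
  apply: eq_plaw_integral => // x x0.
  by rewrite indicE mem_set ?mulr1// /D/= in_itv/= x0.
transitivity (fine (\int[l1]_a ((cf (t * a) * \1_D a)%:E *
                 (\int[l2]_b cf (t * b))%:E))%E).
  rewrite /Rintegral ge0_integral_kendall//; congr fine.
  apply: eq_integral => a _; rewrite -plawE -ge0_integralZl//; last 2 first.
  - by move=> b _; rewrite lee_fin mulr_ge0 ?kendall_cf_ge0.
  - by rewrite lee_fin mulr_ge0 ?kendall_cf_ge0.
  apply: eq_integral => b _; rewrite !indicE.
  have [/set_mem aD|_] := boolP (a \in D); last by rewrite mul0r mul0e mulr0 mul0e.
  have [/set_mem bD|_] := boolP (b \in D); last by rewrite mulr0 mul0e mulr0 mule0.
  move: aD bD; rewrite /D/= !in_itv/= !andbT => a0 b0.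
  by rewrite integral_kendall_dirac_cf// !mulr1 mul1e EFinM.
rewrite ge0_integralZr//; last 2 first.
- by move=> a _; rewrite lee_fin mulr_ge0 ?kendall_cf_ge0.
- by rewrite lee_fin Rintegral_ge0// => b _; exact: kendall_cf_ge0.
by rewrite plawE.
Qed.

End kendall_integral.

(** * Injectivity of the Williamson transform *)

Section williamson.
Context {R : realType}.
Variable alpha : {posnum R}.
Local Notation al := (alpha%:num).
Local Notation cf := (kendall_cf al).

(** Up to the factor [u], this is [cf (t s)] in the variable [u = t^(- al)]. In [u] it is piecewise
    affine, and its right derivative is the indicator of [|s|^al <= u]. *)
Let w (u s : R) : R := Num.max 0 (u - `|s| `^ al).

Let mw u : measurable_fun setT (w u).
Proof.
apply: measurable_maxr => //; apply: measurable_funB => //.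
by apply: (measurableT_comp (@measurable_powR R al)); exact: normr_measurable.
Qed.

Let wE (u s : R) : 0 < u -> w u s = u * cf (u `^ (- al^-1) * s).
Proof.
move=> u0; rewrite /w /kendall_cf normrM (ger0_norm (powR_ge0 _ _)) powRM ?powR_ge0//.
rewrite -powRrM mulNr mulVf// powR_inv1 ?(ltW u0)//.
by rewrite maxr_pMr ?(ltW u0)// mulr0 mulrBr mulr1 mulrA mulfV ?mul1r// gt_eqF.
Qed.

Let w0 s : w 0 s = 0.
Proof. by rewrite /w sub0r max_l// oppr_le0 powR_ge0. Qed.

Let w_lipschitz (u e s : R) : 0 <= e -> 0 <= w (u + e) s - w u s <= e.
Proof.
move=> e0; rewrite /w; move: (`|s| `^ al) => p.
by have [h1|h1] := leP 0 (u + e - p); have [h2|h2] := leP 0 (u - p);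
  apply/andP; split; lra.
Qed.

Let w_integrable (l : plaw R) (u : R) : 0 <= u -> l.-integrable setT (EFin \o w u).
Proof.
move=> u0; apply: (@law_integrable _ l _ u) => // s.
have := powR_ge0 `|s| al; rewrite /w; move: (`|s| `^ al) => p p0.
by have [h1|h1] := leP 0 (u - p); rewrite ger0_norm; lra.
Qed.

(** The transforms give the means of [w u] for all [u]. Difference quotients in [u] at [v = a^al]
    are bounded by [1] and converge to the indicator of [s <= a] for [s >= 0], so the distribution
    functions agree. *)
Lemma plaw_eq_kendall_cf (l l' : plaw R) :
  (forall t : R, 0 <= t -> \int[l]_s cf (t * s) = \int[l']_s cf (t * s)) -> l ≡μ l'.
Proof.
move=> ll'; apply: law_eq_rays_Rintegral => a.
have mI (b : R) : measurable_fun setT (fun s : R => (\1_(`]b, +oo[%classic : set R) s)%:E).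
  by apply/measurable_EFinP; exact: measurable_indic.
have [a0|a0] := ltP a 0.
  have E (k : plaw R) : \int[k]_s \1_(`]a, +oo[%classic : set R) s = 1.
    rewrite -(law_Rintegral_cst k 1); congr fine; apply: eq_plaw_integral => // x x0.
    by rewrite indicE mem_set//= in_itv/= andbT (lt_le_trans a0 x0).
  by rewrite !E.
pose v := a `^ al.
have v0 : 0 <= v := powR_ge0 _ _.
have E (u : R) : 0 <= u -> \int[l]_s w u s = \int[l']_s w u s.
  rewrite le_eqVlt => /predU1P[<-|u0].
    by under eq_Rintegral do rewrite w0; under [RHS]eq_Rintegral do rewrite w0;
      rewrite !law_Rintegral_cst.
  have F (k : plaw R) : \int[k]_s w u s = u * \int[k]_s cf (u `^ (- al^-1) * s).
    rewrite -RintegralZl//; last first.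
      apply: (@law_integrable _ k (fun s => cf (u `^ (- al^-1) * s)) 1).
        apply: (measurableT_comp (measurable_kendall_cf alpha)).
        exact: measurable_funM.
      by move=> x; exact: kendall_cf_le1.
    by apply: eq_Rintegral => s _; rewrite wE.
  by rewrite !F ll'// powR_ge0.
pose q (n : nat) (s : R) : R := n.+1%:R * (w (v + n.+1%:R^-1) s - w v s).
have n0 (n : nat) : 0 <= v + n.+1%:R^-1 :> R by rewrite addr_ge0.
have mq n : measurable_fun setT (q n).
  by apply: measurable_funM => //; apply: measurable_funB; exact: mw.
have q1 n s : `|q n s| <= 1.
  have e0 : 0 <= n.+1%:R^-1 :> R by [].
  have /andP[h1 h2] := w_lipschitz v s e0.
  rewrite /q ger0_norm ?mulr_ge0//.
  by rewrite -ler_pdivlMl// mulr1.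
(* The increments are to the right of [v], so the equality case counts as [1] and the complement is
   exactly the open ray. *)
pose I (s : R) : R := (`|s| `^ al <= v)%R%:R.
have qI s : q n s @[n --> \oo] --> I s.
  rewrite /I; case: leP => sv; apply: cvg_near_cst.
    apply: nearW => n; rewrite /q /w !max_r ?subr_ge0//.
      by rewrite opprB addrA subrK addrC addrA addNr add0r mulfV.
    by rewrite (le_trans sv)// lerDl.
  have d0 : 0 < `|s| `^ al - v by rewrite subr_gt0.
  near=> n; rewrite /q /w !max_l ?subr_le0 ?(ltW sv)// ?subrr ?mulr0//.
  rewrite -lerBrDl ltW//; near: n; exact: (near_infty_natSinv_lt (PosNum d0)).
have Eq n : \int[l]_s q n s = \int[l']_s q n s.
  have F (k : plaw R) : \int[k]_s q n s =
      n.+1%:R * (\int[k]_s w (v + n.+1%:R^-1) s - \int[k]_s w v s).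
    rewrite -RintegralB//; [|exact: w_integrable|exact: w_integrable].
    rewrite -RintegralZl//.
    by apply: (integrableB _ (w_integrable _ _) (w_integrable _ _)).
  by rewrite !F !E.
have EI : \int[l]_s I s = \int[l']_s I s.
  have L (k : plaw R) := @law_Rintegral_cvg _ k q I 1 mq q1 qI.
  apply: (cvg_unique (@Rhausdorff R) (L l)); apply: cvg_trans (L l').
  by apply: near_eq_cvg; apply: nearW => n; rewrite Eq.
have mI' : measurable_fun setT I by apply: (measurable_fun_cvg mq) => x _; exact: qI.
have F (k : plaw R) : \int[k]_s \1_(`]a, +oo[%classic : set R) s = 1 - \int[k]_s I s.
  rewrite -[X in X - _](law_Rintegral_cst k 1) -RintegralB//; last 2 first.
  - by apply: (@law_integrable _ k (fun=> 1) 1) => // x; rewrite normr1.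
  - apply: (@law_integrable _ k I 1) => // x; rewrite /I.
    by case: (_ <= v); rewrite ?normr1 ?normr0.
  congr fine; apply: eq_plaw_integral => //.
    by apply/measurable_EFinP; exact: measurable_funB.
  move=> s s0; congr EFin; rewrite indicE mem_setE in_itv/= andbT /I ger0_norm//.
  have -> : (s `^ al <= v) = (s <= a).
    apply/idP/idP => sa; last by rewrite ge0_ler_powR ?nnegrE.
    rewrite leNgt; apply/negP => h; move: sa; rewrite leNgt => /negP; apply.
    by rewrite gt0_ltr_powR ?nnegrE.
  by case: leP; rewrite ?subrr ?subr0.
by rewrite !F EI.
Unshelve. all: by end_near. Qed.

End williamson.

(** * Uniqueness of the generating law *)

Section functional_equation.
Context {R : realType}.
Variables (al : R) (phi : R -> R).
Hypotheses (al_gt0 : 0 < al) (cphi : continuous phi) (phi0 : phi 0 = 1).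
Hypothesis phi1 : forall t, `|phi t| <= 1.
Hypothesis phiP : forall t x, 0 <= t -> phi t != 0 -> 0 <= x -> x <= 1 ->
  phi (t * x) = 1 - x `^ al * (1 - phi t).

(** Off its zeros, [phi] coincides with [1 - c1 t^al] for a single [c1]. Continuity forbids a zero
    while this expression is positive, and [|phi| <= 1] together with continuity forces [phi = 0]
    once it is negative. *)
Lemma kendall_functional_equation : (forall t, 0 <= t -> phi t = 1) \/
  exists2 c, 0 < c & forall t, 0 <= t -> phi t = kendall_cf al (t * c).
Proof.
have IV (a b y : R) : a <= b -> phi a <= y <= phi b \/ phi b <= y <= phi a ->
    exists2 s, a <= s <= b & phi s = y.
  move=> ab aby.
  have /(IVT ab (continuous_subspaceT cphi))[s] :
      Num.min (phi a) (phi b) <= y <= Num.max (phi a) (phi b).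
    by rewrite ge_min le_max; case: aby => /andP[-> ->]; rewrite ?orbT.
  by rewrite in_itv/= => sab <-; exists s.
have [all1|] := pselect (forall t, 0 <= t -> phi t = 1); first by left.
move=> /existsNP[t0 /not_implyP[t00 /eqP t01]]; right.
(* If [phi t0 = 0], the value [1/2] is taken between [0] and [t0]. *)
have [t1 [t10 t1n0 t1n1]] : exists t1, [/\ 0 <= t1, phi t1 != 0 & phi t1 != 1].
  have [t0z|t0z] := eqVneq (phi t0) 0; last by exists t0.
  have [|s /andP[s0 _] sE] := IV 0 t0 (2^-1) t00.
    by right; rewrite phi0 t0z; lra.
  by exists s; rewrite sE; split => //; apply/eqP; lra.
have t1gt : 0 < t1.
  by rewrite lt_neqAle t10 andbT; apply: contra t1n1 => /eqP <-; rewrite phi0.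
have ph_le1 t : phi t <= 1 by rewrite (le_trans (ler_norm _)).
have ph_geN1 t : -1 <= phi t by have /ler_normlP[] := phi1 t; lra.
pose c1 := (1 - phi t1) / t1 `^ al.
have p1 : 0 < t1 `^ al by rewrite powR_gt0.
have c10 : 0 < c1 by rewrite divr_gt0// subr_gt0 lt_neqAle t1n1 ph_le1.
(* The equation is applied at the larger of [t] and [t1], the smaller being a multiple of it by a
   factor in [[0, 1]]. *)
have main t : 0 <= t -> phi t != 0 -> phi t = 1 - c1 * t `^ al.
  move=> tge tn0; have [tt1|tt1] := leP t t1.
    have x1 : t / t1 <= 1 by rewrite ler_pdivrMr// mul1r.
    have x0 : 0 <= t / t1 by rewrite divr_ge0.
    have := phiP t10 t1n0 x0 x1; rewrite mulrC divfK ?gt_eqF// => ->.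
    rewrite powRM ?invr_ge0//= -powR_inv1// -powRrM mulN1r powRN /c1.
    by ring.
  have tgt : 0 < t by exact: lt_trans tt1.
  have x1 : t1 / t <= 1 by rewrite ler_pdivrMr// mul1r ltW.
  have x0 : 0 <= t1 / t by rewrite divr_ge0.
  have pt : 0 < t `^ al by rewrite powR_gt0.
  have := phiP tge tn0 x0 x1; rewrite mulrC divfK ?gt_eqF//.
  rewrite powRM ?invr_ge0//= -(powR_inv1 tge) -powRrM mulN1r powRN => E.
  rewrite /c1 E; have := gt_eqF p1; have := gt_eqF pt.
  move: (t `^ al) (t1 `^ al) => u v /negbT u0 /negbT v0.
  by field; rewrite u0 v0.
have mono (s t : R) : 0 <= s -> s <= t -> c1 * s `^ al <= c1 * t `^ al.
  move=> s0 st; rewrite ler_pM2l// ge0_ler_powR ?nnegrE ?(ltW al_gt0)//.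
  exact: le_trans st.
have small t : 0 <= t -> 0 < 1 - c1 * t `^ al -> phi t != 0.
  move=> tge pos; apply/eqP => pt0.
  (* If [phi t = 0], then [phi] takes the nonzero value [y] at some [s <= t], where by [main] it is
     at least [2 y]. *)
  pose y := (1 - c1 * t `^ al) / 2.
  have y0 : 0 < y by rewrite divr_gt0.
  have c1t : 0 <= c1 * t `^ al by rewrite mulr_ge0 ?powR_ge0// ltW.
  have [|s /andP[s0 st] sE] := IV 0 t y tge.
    by right; rewrite phi0 pt0; rewrite /y in y0 *; lra.
  have : phi s = 1 - c1 * s `^ al by apply: main => //; rewrite sE gt_eqF.
  by have := mono _ _ s0 st; rewrite sE /y in y0 *; lra.
have large t : 0 <= t -> 1 - c1 * t `^ al < 0 -> phi t = 0.
  move=> tge neg; apply/eqP; apply: contraT => ptn0.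
  have pt := main _ tge ptn0.
  pose b := (3 / c1) `^ al^-1.
  have bE : c1 * b `^ al = 3.
    have h3 : 0 <= 3 / c1 by rewrite divr_ge0// ltW.
    have al0 : al != 0 by rewrite gt_eqF.
    by rewrite /b -powRrM mulVf// powRr1// mulrC divfK// gt_eqF.
  have b0 : 0 <= b := powR_ge0 _ _.
  have phib : phi b = 0.
    apply/eqP; apply: contraT => pb; have := main _ b0 pb; have := ph_geN1 b.
    by lra.
  have tb : t <= b.
    rewrite leNgt; apply/negP => /ltW bt; have := mono _ _ b0 bt.
    by have := ph_geN1 t; rewrite pt; lra.
  (* A negative [phi t] is halved at some [s >= t], yet by [main] the value at [s] cannot exceed
     [phi t]. *)
  have [|s /andP[ts _] sE] := IV t b (phi t / 2) tb.
    by left; rewrite phib; rewrite -pt in neg; lra.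
  have : phi s = 1 - c1 * s `^ al.
    apply: main; first exact: le_trans ts.
    by rewrite sE mulf_neq0 ?invr_eq0.
  by have := mono _ _ tge ts; rewrite sE pt; lra.
exists (c1 `^ al^-1); first by rewrite powR_gt0.
move=> t tge; rewrite /kendall_cf ger0_norm ?mulr_ge0 ?powR_ge0//.
rewrite powRM ?powR_ge0// -powRrM mulVf ?gt_eqF// powRr1 ?(ltW c10)// mulrC.
have [h|h|h] := ltgtP (1 - c1 * t `^ al) 0.
- by rewrite large// max_l// ltW.
- by rewrite main// ?small// max_r// ltW.
- have [p|p] := eqVneq (phi t) 0; first by rewrite p.
  by rewrite main// h.
Qed.

End functional_equation.

Section dirac_laws.
Context {R : realType}.
Notation law := (probability (measurableTypeR R) R).

Let dirac_ge0 (a : R) : 0 <= a ->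
  (\d_(a : measurableTypeR R) : law) `[0, +oo[%classic = 1%E.
Proof. by move=> a0; rewrite /= diracE mem_set//= in_itv/= a0. Qed.

Definition plaw_dirac (a : R) (a0 : 0 <= a) : plaw R := Plaw (dirac_ge0 a0).

Lemma integral_plaw_dirac a (a0 : 0 <= a) (f : R -> \bar R) :
  measurable_fun setT f -> (\int[plaw_dirac a0]_x f x = f a)%E.
Proof. by move=> mf; rewrite integral_dirac// diracT mul1e. Qed.

Lemma Rintegral_plaw_dirac a (a0 : 0 <= a) (f : R -> R) :
  measurable_fun setT f -> \int[plaw_dirac a0]_x f x = f a.
Proof.
by move=> mf; rewrite /Rintegral integral_plaw_dirac//; exact/measurable_EFinP.
Qed.

Lemma ge0_integral_kendall_plaw_dirac (alpha : {posnum R}) a b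
    (a0 : 0 <= a) (b0 : 0 <= b) (h : R -> \bar R) :
  measurable_fun setT h -> (forall x, 0 <= h x)%E ->
  (\int[kendall alpha (plaw_dirac a0) (plaw_dirac b0)]_s h s =
   \int[kendall_dirac alpha a b]_s h s)%E.
Proof.
move=> mh h0; rewrite ge0_integral_kendall//.
set D : set R := [set` _].
pose I p := ((\1_D p.1 * \1_D p.2)%:E * \int[kendall_dirac alpha p.1 p.2]_s h s)%E.
have mD : measurable D by exact: measurable_itv.
have mI : measurable_fun setT I.
  apply: emeasurable_funM; last exact: measurable_integral_kendall_dirac.
  apply/measurable_EFinP; apply: measurable_funM.
    exact: (measurableT_comp (@measurable_indic _ _ R setT D mD) measurable_fst).
  exact: (measurableT_comp (@measurable_indic _ _ R setT D mD) measurable_snd).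
transitivity (\int[plaw_dirac a0]_x I (x, b))%E.
  apply: eq_integral => x _; rewrite (@integral_plaw_dirac b b0 (fun y => I (x, y))); first by [].
  exact: (measurableT_comp mI (pair1_measurable x)).
rewrite (@integral_plaw_dirac a a0 (fun x => I (x, b))).
  have DE c : 0 <= c -> c \in D by move=> c0; rewrite inE /D/= in_itv/= c0.
  by rewrite /I/= !indicE !DE// mulr1 mul1e.
exact: (measurableT_comp mI (pair2_measurable b)).
Qed.

End dirac_laws.

(** * Generation of the Kendall convolution, and uniqueness *)

Section main.
Context {R : realType}.
Variable alpha : {posnum R}.
Local Notation al := (alpha%:num).
Local Notation cf := (kendall_cf al).
Notation law := (probability (measurableTypeR R) R).

Section generation.
Variable mu : law.
Hypothesis smu : symmetric_law mu.
Hypothesis ctmu : forall t, cos_transform mu t = cf t.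

Let ct_product (l : plaw R) t :
  cos_transform (product_law l mu) t = \int[l]_s cf (t * s).
Proof.
by rewrite cos_transform_product_law; apply: eq_Rintegral => s _; rewrite ctmu.
Qed.

Let kendall_product (l1 l2 : plaw R) :
  convolution (product_law l1 mu) (product_law l2 mu) ≡μ
  product_law (kendall alpha l1 l2) mu.
Proof.
have sp (l : plaw R) : symmetric_law (product_law l mu).
  exact: symmetric_product_law.
apply: cos_transform_inj.
- by apply: symmetric_convolution; exact: sp.
- exact: sp.
move=> t t0; rewrite cos_transform_convolution// !ct_product.
by rewrite Rintegral_kendall_cf.
Qed.

(** The converse implication has to cancel [mu] from [product_law l mu]. The transform of that
    product is the Williamson transform of [l], which determines [l]. *)
Lemma kendall_cf_is_weak_convolution : is_weak_convolution mu (kendall alpha).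
Proof.
move=> l1 l2 l; have K := kendall_product l1 l2.
split=> [kl A mA|kl].
  rewrite K//; move: A mA; apply: cos_transform_inj; try exact: symmetric_product_law.
  by move=> t t0; rewrite !ct_product; exact: eq_law_Rintegral.
apply: (@plaw_eq_kendall_cf _ alpha) => t t0.
rewrite -(ct_product (kendall alpha l1 l2)) -(ct_product l).
apply: eq_cos_transform => A mA.
by rewrite -K// kl.
Qed.

Lemma kendall_cf_weakly_stable : weakly_stable mu.
Proof.
move=> a b.
(* Absolute values bring the point masses into [[0, +oo[]; [cf] is even, so the signs of [a] and [b]
   are invisible. *)
exists (kendall alpha (plaw_dirac (normr_ge0 a)) (plaw_dirac (normr_ge0 b))).
have sd c : symmetric_law (dilation c mu) by exact: symmetric_dilation.
apply: cos_transform_inj; first exact: symmetric_convolution.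
  exact: symmetric_product_law.
move=> t t0; rewrite cos_transform_convolution// !cos_transform_dilation !ctmu.
have mcf : measurable_fun setT (fun s : R => cf (t * s)).
  apply: (measurableT_comp (measurable_kendall_cf alpha)).
  exact: measurable_funM.
rewrite ct_product Rintegral_kendall_cf// !Rintegral_plaw_dirac//.
by rewrite /kendall_cf !normrM !normr_id.
Qed.

Lemma kendall_cf_weakly_generated : weakly_generated (kendall alpha) mu.
Proof.
split; [exact: smu|exact: kendall_cf_weakly_stable|].
exact: kendall_cf_is_weak_convolution.
Qed.

End generation.

Section uniqueness.
Variable nu : law.
Hypothesis gnu : weakly_generated (kendall alpha) nu.
Let phi := cos_transform nu.

Let snu : symmetric_law nu. Proof. by have [] := gnu. Qed.
Let wnu : is_weak_convolution nu (kendall alpha). Proof. by have [] := gnu. Qed.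

Let mphi t : measurable_fun setT (fun s : R => phi (t * s)).
Proof.
apply: (@measurableT_comp _ _ _ _ _ _ phi); last exact: measurable_funM.
by apply: continuous_measurable_fun; exact: continuous_cos_transform.
Qed.

Let phi_le1 t : `|phi t| <= 1. Proof. exact: cos_transform_le1. Qed.

Let ct_conv (l1 l2 : plaw R) t :
  (\int[l1]_s phi (t * s)) * (\int[l2]_s phi (t * s)) =
  \int[kendall alpha l1 l2]_s phi (t * s).
Proof.
rewrite -!cos_transform_product_law -cos_transform_convolution; last first.
  exact: symmetric_product_law.
by apply: eq_cos_transform; apply/wnu.
Qed.

(** The convolution of the point masses at [x] and [1] is affine in [x^al]. What matters is that
    [K], which contains the Pareto mean of [phi (t s)], does not depend on [x]. *)
Let phi_kendall_unit t : exists K, forall x, 0 <= x -> x <= 1 ->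
  phi (t * x) * phi t = phi t - x `^ al * K.
Proof.
(* The shift by [1] makes the integrand nonnegative. *)
pose h (s : R) : \bar R := (1 + phi (t * s))%:E.
have mh : measurable_fun setT h by apply/measurable_EFinP; exact: measurable_funD.
have h0 s : (0 <= h s)%E.
  by rewrite lee_fin; have /ler_normlP[] := phi_le1 (t * s); lra.
have i1 (l : law) : l.-integrable setT (EFin \o (fun s => phi (t * s))).
  by apply: (@law_integrable _ l _ 1) => //.
have ic (l : law) : l.-integrable setT (EFin \o (fun=> 1 : R)).
  by apply: (@law_integrable _ l (fun=> 1) 1) => // x; rewrite normr1.
have hE (l : law) : (\int[l]_s h s = (1 + \int[l]_s phi (t * s))%:E)%E.
  have -> : 1 + \int[l]_s phi (t * s) = \int[l]_s (1 + phi (t * s)).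
    rewrite (RintegralD measurableT (ic l) (i1 l)); congr (_ + _).
    exact/esym/law_Rintegral_cst.
  apply/esym/fineK/integrable_fin_num; first by [].
  exact: (integrableD measurableT (ic l) (i1 l)).
exists (phi t - \int[pareto_prob (twice alpha)]_s phi (t * s)) => x x0 x1.
have := ct_conv (plaw_dirac x0) (plaw_dirac (@ler01 R)) t.
rewrite !Rintegral_plaw_dirac// mulr1 => ->.
have := hE (kendall alpha (plaw_dirac x0) (plaw_dirac (@ler01 R))).
rewrite ge0_integral_kendall_plaw_dirac// ge0_integral_kendall_dirac//; last first.
  by rewrite lt_max ltr01 orbT.
rewrite (max_r x1) (min_l x1) divr1.
have -> : (\int[pareto_prob (twice alpha)]_s h (1 * s)%R =
    (1 + \int[pareto_prob (twice alpha)]_s phi (t * s))%:E)%E.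
  by rewrite -hE; apply: eq_integral => s _; rewrite mul1r.
rewrite /h mulr1 -!EFinM -EFinD => -[] E; apply: (addrI 1).
apply: (etrans (esym E)); ring.
Qed.

(** Taking [x = 1] identifies the unknown constant as [K = phi t (1 - phi t)]; then [phi t] is
    divided out. *)
Let phi_scale t x : phi t != 0 -> 0 <= x -> x <= 1 ->
  phi (t * x) = 1 - x `^ al * (1 - phi t).
Proof.
move=> pt x0 x1; have [K HK] := phi_kendall_unit t.
have := HK 1 ler01 (lexx 1); rewrite mulr1 powR1 mul1r => H1.
have KE : K = phi t * (1 - phi t) by lra.
apply: (@mulIf R (phi t)) => //; rewrite HK// KE; ring.
Qed.

(** If [phi] were constant, all products with [nu] would have the same transform, so that every law
    would be the Kendall convolution of every pair. The point masses at [0] and [1] would then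
    coincide. *)
Let phi_not_cst : ~ (forall t, 0 <= t -> phi t = 1).
Proof.
move=> phi1.
have ct1 (l : plaw R) t : 0 <= t -> cos_transform (product_law l nu) t = 1.
  move=> t0; rewrite cos_transform_product_law -[RHS](law_Rintegral_cst l 1).
  apply: eq_Rintegral => s _; rewrite -/phi -[phi _]cos_transform_abs.
  exact: phi1.
have all_eq (l1 l2 l : plaw R) : kendall alpha l1 l2 ≡μ l.
  apply/wnu; apply: cos_transform_inj.
  - by apply: symmetric_convolution; exact: symmetric_product_law.
  - exact: symmetric_product_law.
  - move=> t t0; rewrite cos_transform_convolution ?ct1 ?mulr1//.
    exact: symmetric_product_law.
pose d0 := plaw_dirac (lexx (0 : R)); pose d1 := plaw_dirac (@ler01 R).
have m0 : measurable ([set 0] : set R) by exact: measurable_set1.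
have := all_eq d0 d0 d0 _ m0; rewrite (all_eq d0 d0 d1 _ m0)/= !diracE.
have -> : (0 : R) \in ([set 0] : set R) by rewrite inE.
have -> : (1 : R) \in ([set 0] : set R) = false.
  by apply: memNset => /= /eqP; rewrite oner_eq0.
by move=> [] /eqP; rewrite eq_sym oner_eq0.
Qed.

Lemma weakly_generated_kendall_cf :
  exists2 c, 0 < c & forall t, 0 <= t -> cos_transform nu t = cf (t * c).
Proof.
have phi0 : phi 0 = 1 by exact: cos_transform0.
have := @kendall_functional_equation R al phi (gt0 alpha) (continuous_cos_transform (m := nu))
  phi0 phi_le1 (fun t x _ => @phi_scale t x).
by case=> // /phi_not_cst.
Qed.

End uniqueness.

End main.

(** Uniqueness is up to a dilation because rescaling [mu] by [c > 0] rescales both sides of the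
    defining relation of the weak convolution alike. *)
Theorem theorem2 (R : realType) (alpha : {posnum R})
    (alpha_le1 : alpha%:num <= 1) :
  weak_generalized_convolution (kendall alpha) /\
  exists mu : probability (measurableTypeR R) R,
    [/\ has_density mu (kendall_pdf alpha%:num),
        weakly_generated (kendall alpha) mu &
        forall nu : probability (measurableTypeR R) R,
          weakly_generated (kendall alpha) nu ->
          exists2 c : R, 0 < c & nu ≡μ dilation c mu].
Proof.
have [mu [dmu smu ctmu]] : exists mu : probability (measurableTypeR R) R,
    [/\ has_density mu (kendall_pdf alpha%:num), symmetric_law mu &
        forall t, cos_transform mu t = kendall_cf alpha%:num t].
  exists (kendall_law (gt0 alpha) alpha_le1); split.
  - exact: has_density_kendall_law.
  - exact: symmetric_kendall_law.
  - exact: cos_transform_kendall_law.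
have gmu := kendall_cf_weakly_generated smu ctmu.
split; first by exists mu.
exists mu; split.
- exact: dmu.
- exact: gmu.
- move=> nu gnu; have [c c0 nuE] := weakly_generated_kendall_cf gnu.
  exists c => //; apply: cos_transform_inj.
  + by have [] := gnu.
  + exact: symmetric_dilation.
  + by move=> t t0; rewrite nuE// cos_transform_dilation ctmu.
Qed.
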